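(* $3\textsc{-Strict}$ is $P$-hard.
   Context: A game is a pair $(A,B)$ of real $n\times m$ payoff matrices ($A$ for the row player, $B$ for the column player). A subgame is a pair $(I,J)$ with $I\subseteq\{1,\dots,n\}$, $J\subseteq\{1,\dots,m\}$. Strict dominance: $(I,J)\to_{<<}(I\setminus\{i\},J)$ if there is $i_0\in I$ with $A_{i_0,j}>A_{i,j}$ for all $j\in J$; $(I,J)\to_{<<}(I,J\setminus\{j\})$ if there is $j_0\in J$ with $B_{i,j_0}>B_{i,j}$ for all $i\in I$; $\rightrightarrows_{<<}$ is the reflexive transitive closure of $\to_{<<}$. The problem $\textsc{Strict}$ takes an $n\times m$ game $(A,B)$ and a row strategy $1\le i\le n$, and answers yes iff there are $I,J$ with $(\{1,\dots,n\},\{1,\dots,m\})\rightrightarrows_{<<}(I,J)$ and $i\notin I$. $3\textsc{-Strict}$ is its restriction to games with at most $3$ different payoff values, i.e. $|\{A_{ij}\}\cup\{B_{ij}\}|\le 3$. $P$-hardness is with respect to logarithmic-space many-one reductions. *)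

(* Defs.v *)
From HB Require Import structures.
From mathcomp Require Import all_boot all_order all_algebra.
From mathcomp Require Import reals.
Set Implicit Arguments.
Unset Strict Implicit.
Unset Printing Implicit Defensive.
Import Order.TTheory GRing.Theory Num.Theory.

(** * Iterated elimination of strictly dominated strategies *)

Section Games.
Local Open Scope ring_scope.
Variables (R : realType) (n m : nat).
Implicit Types (A B : 'M[R]_(n, m)) (S T : {set 'I_n} * {set 'I_m}).

Definition strict_step A B : rel ({set 'I_n} * {set 'I_m}) := fun S T =>
  [exists i, (T == (S.1 :\ i, S.2)) &&
     [exists i0 in S.1, [forall j in S.2, A i0 j > A i j]]]
  || [exists j, (T == (S.1, S.2 :\ j)) &&
     [exists j0 in S.2, [forall i in S.1, B i j0 > B i j]]].

Definition strict A B (i : 'I_n) : Prop :=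
  exists2 S, connect (strict_step A B) ([set: 'I_n], [set: 'I_m]) S
           & i \notin S.1.

Definition payoff_values A B : seq R :=
  undup ([seq A p.1 p.2 | p : 'I_n * 'I_m] ++ [seq B p.1 p.2 | p : 'I_n * 'I_m]).

End Games.

(** * Problem instances as words *)

(* Payoffs of an instance are rational, so that instances are finite objects;
   they are read as real games through [ratr]. *)
Record instance := Instance {
  rows : nat;
  cols : nat;
  row_payoff : 'M[rat]_(rows, cols);
  col_payoff : 'M[rat]_(rows, cols);
  query : 'I_rows }.

Inductive symbol := Zero | One | Minus | Slash | Comma | Semicolon | Bar.

(* Not [inord], so that equality of symbols computes. *)
Definition symbol_code (s : symbol) : 'I_7 :=
  match s with
  | Zero => @Ordinal 7 0 isT | One => @Ordinal 7 1 isT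
  | Minus => @Ordinal 7 2 isT | Slash => @Ordinal 7 3 isT
  | Comma => @Ordinal 7 4 isT | Semicolon => @Ordinal 7 5 isT
  | Bar => @Ordinal 7 6 isT
  end.
Definition symbol_decode (i : 'I_7) : symbol :=
  nth Zero [:: Zero; One; Minus; Slash; Comma; Semicolon; Bar] i.
Lemma symbol_codeK : cancel symbol_code symbol_decode.
Proof. by case. Qed.
HB.instance Definition _ := Finite.copy symbol (can_type symbol_codeK).

(* Binary notation, most significant digit first, without leading zeros
   (and [:: Zero] for 0). *)
Definition encode_nat (k : nat) : seq symbol :=
  [seq if odd (k %/ 2 ^ e) then One else Zero
     | e <- rev (iota 0 (trunc_log 2 k).+1)].

Definition encode_rat (q : rat) : seq symbol :=
  (if (q < 0)%R then [:: Minus] else [::])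
    ++ encode_nat `|numq q|%N ++ Slash :: encode_nat `|denq q|%N.

Definition encode_row m (v : 'I_m -> rat) : seq symbol :=
  flatten [seq rcons (encode_rat (v j)) Comma | j <- enum 'I_m].

Definition encode_mx n m (A : 'M[rat]_(n, m)) : seq symbol :=
  flatten [seq rcons (encode_row (A i)) Semicolon | i <- enum 'I_n].

Definition encode (x : instance) : seq symbol :=
  encode_nat (query x) ++ Bar :: encode_mx (row_payoff x)
    ++ Bar :: encode_mx (col_payoff x).

(* Words determine instances: [encode_inj]. *)
Lemma delim_inj (d : symbol) s1 s2 t1 t2 : d \notin s1 -> d \notin s2 ->
  s1 ++ d :: t1 = s2 ++ d :: t2 -> s1 = s2 /\ t1 = t2.
Proof.
elim: s1 s2 => [|a s1 IH] [|b s2] //=.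
- by move=> _ _ [->].
- by move=> _; rewrite inE negb_or => /andP[/eqP nb _] [].
- by rewrite inE negb_or => /andP[/eqP nb _] _ [/esym].
rewrite !inE !negb_or => /andP[_ h1] /andP[_ h2] [-> /(IH _ h1 h2)[-> ->]] //.
Qed.

Lemma flat_inj (d : symbol) ss tt : all (fun s => d \notin s) ss ->
  all (fun s => d \notin s) tt ->
  flatten [seq rcons s d | s <- ss] = flatten [seq rcons s d | s <- tt] ->
  ss = tt.
Proof.
elim: ss tt => [|s ss IH] [|t tt] //=; rewrite -?cats1 ?cat_rcons.
- by case: t.
- by case: s.
rewrite -!catA /= => /andP[h1 h2] /andP[h3 h4] /(delim_inj h1 h3)[-> /(IH _ h2 h4)->] //.
Qed.

Lemma encode_nat_mem k s : s \in encode_nat k -> s = Zero \/ s = One.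
Proof. by case/mapP => e _ ->; case: odd; [right|left]. Qed.

Lemma encode_nat_inj : injective encode_nat.
Proof.
move=> k l E.
have Eb : [seq odd (k %/ 2 ^ e) | e <- iota 0 (trunc_log 2 k).+1] =
          [seq odd (l %/ 2 ^ e) | e <- iota 0 (trunc_log 2 l).+1].
  move: E; rewrite /encode_nat !map_rev => /(can_inj revK).
  rewrite (map_comp (fun b : bool => if b then One else Zero)
             (fun e => odd (k %/ 2 ^ e))).
  rewrite (map_comp (fun b : bool => if b then One else Zero)
             (fun e => odd (l %/ 2 ^ e))).
  by apply: inj_map => [[] []].
have /= := congr1 size Eb; rewrite !size_map !size_iota => Es.
have rec j n : j < 2 ^ n -> j = \sum_(0 <= e < n) odd (j %/ 2 ^ e) * 2 ^ e.
  elim: n j => [|n IH] j lt; first by rewrite big_nil; case: j lt.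
  rewrite big_nat_recl // expn0 divn1 muln1 -[LHS]odd_double_half; congr (_ + _).
  rewrite -muln2 (IH j./2); last by rewrite -divn2 ltn_divLR // mulnC -expnS.
  rewrite big_distrl /=; apply: eq_bigr => e _.
  by rewrite expnS -divn2 -divnMA -mulnA [2 ^ e * 2]mulnC.
have b j : j < 2 ^ (trunc_log 2 j).+1 by apply: trunc_log_ltn.
rewrite (rec _ _ (b k)) (rec _ _ (b l)).
case: Es Eb => <- /eq_in_map Eb; apply: eq_big_seq => e.
by rewrite mem_index_iota => He; rewrite Eb // mem_iota.
Qed.

Lemma notin_nat (d : symbol) : d != Zero -> d != One -> forall k, d \notin encode_nat k.
Proof. by move=> h0 h1 k; apply/negP => /encode_nat_mem[]E; move: h0 h1; rewrite E. Qed.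

Lemma notin_rat (d : symbol) q : d \in [:: Comma; Semicolon; Bar] -> d \notin encode_rat q.
Proof.
move=> hd; rewrite /encode_rat !mem_cat inE !negb_or.
have [h0 h1] : d != Zero /\ d != One by move: hd; rewrite !inE => /or3P[]/eqP->.
rewrite !(notin_nat h0 h1) /= andbT.
by move: hd; rewrite !inE => /or3P[]/eqP->; case: ifP.
Qed.

Lemma encode_rat_inj : injective encode_rat.
Proof.
move=> p q; rewrite /encode_rat => E.
have N r : forall s, exists x, encode_nat r ++ s = x /\ head Zero x != Minus.
  move=> s; eexists; split; first by [].
  have: size (encode_nat r) != 0 by rewrite size_map size_rev size_iota.
  have := @encode_nat_mem r; case: encode_nat => //= a l H _.
  by case: (H a); rewrite ?mem_head // => ->.
have [Es Et] : (p < 0)%R = (q < 0)%R /\ 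
   encode_nat `|numq p|%N ++ Slash :: encode_nat `|denq p|%N =
   encode_nat `|numq q|%N ++ Slash :: encode_nat `|denq q|%N.
  move: E; case: ltP => _; case: ltP => _ //=.
  - by case.
  - by move=> E; have [x [E1]] := N `|numq q|%N (Slash :: encode_nat `|denq q|%N); rewrite -E1 -E.
  - by move=> E; have [x [E1]] := N `|numq p|%N (Slash :: encode_nat `|denq p|%N); rewrite -E1 E.
have [||/encode_nat_inj En /encode_nat_inj Ed] := delim_inj _ _ Et; try exact: notin_nat.
rewrite -[p]divq_num_den -[q]divq_num_den.
have -> : denq p = denq q by rewrite -(absz_denq p) Ed absz_denq.
have -> // : numq p = numq q.
by rewrite (intEsign (numq p)) (intEsign (numq q)) En !numq_lt0 Es.
Qed.

Lemma enum_size_inj n n' T (f : 'I_n -> T) (g : 'I_n' -> T) :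
  [seq f i | i <- enum 'I_n] = [seq g i | i <- enum 'I_n'] -> n = n'.
Proof. by move/(congr1 size); rewrite 2!size_map 2!size_enum_ord. Qed.

Lemma encode_row_notin d m (v : 'I_m -> rat) : d \in [:: Semicolon; Bar] -> d \notin encode_row v.
Proof.
move=> hd; apply/negP => /flattenP[s /mapP[j _ ->]]; rewrite mem_rcons inE => /orP[/eqP E|].
  by rewrite E in hd.
by apply/negP/notin_rat; move: hd; rewrite !inE => /orP[]/eqP->.
Qed.

Lemma encode_mx_notin n m (A : 'M[rat]_(n, m)) : Bar \notin encode_mx A.
Proof.
apply/negP => /flattenP[s /mapP[j _ ->]]; rewrite mem_rcons inE => /orP[//|].
exact/negP/encode_row_notin.
Qed.

Lemma encode_row_eq m m' (v : 'I_m -> rat) (v' : 'I_m' -> rat) : encode_row v = encode_row v' ->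
  [seq v j | j <- enum 'I_m] = [seq v' j | j <- enum 'I_m'].
Proof.
rewrite /encode_row (map_comp (rcons^~ Comma) (encode_rat \o v))
  (map_comp (rcons^~ Comma) (encode_rat \o v')).
move/flat_inj => H.
have h k (u : 'I_k -> rat) : all (fun s => Comma \notin s) [seq (encode_rat \o u) i | i <- enum 'I_k].
  by apply/allP => s /mapP[j _ ->]; apply: notin_rat.
move: (H (h _ _) (h _ _)); rewrite (map_comp encode_rat v) (map_comp encode_rat v').
exact: (inj_map encode_rat_inj).
Qed.

Lemma encode_mx_eq n n' m m' (A : 'M[rat]_(n, m)) (B : 'M[rat]_(n', m')) : encode_mx A = encode_mx B ->
  [seq encode_row (A i) | i <- enum 'I_n] = [seq encode_row (B i) | i <- enum 'I_n'].
Proof.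
rewrite /encode_mx (map_comp (rcons^~ Semicolon) (fun i => encode_row (A i)))
  (map_comp (rcons^~ Semicolon) (fun i => encode_row (B i))).
move/flat_inj; apply; by apply/allP => s /mapP[j _ ->]; apply: encode_row_notin.
Qed.

Lemma encode_mx_inj n m : injective (@encode_mx n m).
Proof.
move=> A B /encode_mx_eq/eq_in_map E; apply/matrixP => i j.
have /encode_row_eq/eq_in_map -> // := E i (mem_enum _ i).
exact: mem_enum.
Qed.

Lemma encode_inj : injective encode.
Proof.
move=> [n m A B i] [n' m' A' B' i'] /delim_inj[||/= /encode_nat_inj Ei]; try exact: notin_nat.
move=> /delim_inj[||EA EB]; try exact: encode_mx_notin.
have E := encode_mx_eq EA.
have En := enum_size_inj E; subst n'.
have Em : m = m' by move/eq_in_map: E => /(_ i (mem_enum _ i)) /encode_row_eq /enum_size_inj.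
subst m'; by rewrite (encode_mx_inj EA) (encode_mx_inj EB) (val_inj Ei).
Qed.

(* The problem k-Strict: the words encoding a game with at most k different
   payoff values together with a row that can be eliminated. *)
Definition k_strict (R : realType) (k : nat) (w : seq symbol) : Prop :=
  exists x : instance,
    let A := map_mx (ratr : rat -> R) (row_payoff x) in
    let B := map_mx (ratr : rat -> R) (col_payoff x) in
    [/\ w = encode x, size (payoff_values A B) <= k & strict A B (query x)].

(** * Polynomial time *)

Inductive move := Left | Stay | Right.

(* Tapes are infinite to the right only; a head told to move left off the
   first cell stays there. *)
Definition move_head (d : move) (p : nat) : nat :=
  match d with Left => p.-1 | Stay => p | Right => p.+1 end.

(* Deterministic single-tape Turing machines; the tape alphabet consists of
   the blank [None], the input alphabet and the auxiliary symbols.  The machine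
   halts when [tm_next] is [None]. *)
Record machine (Sigma : finType) := Machine {
  tm_state : finType;
  tm_aux : finType;
  tm_start : tm_state;
  tm_accept : pred tm_state;
  tm_next : tm_state -> option (Sigma + tm_aux) ->
              option (tm_state * option (Sigma + tm_aux) * move) }.

Section Machine.
Variables (Sigma : finType) (M : machine Sigma).

Record tm_config := TmConfig {
  tm_cur : tm_state M;
  tm_tape : nat -> option (Sigma + tm_aux M);
  tm_pos : nat }.

Definition tm_init (w : seq Sigma) : tm_config :=
  TmConfig (tm_start M)
    (nth None [seq Some (inl a : Sigma + tm_aux M) | a <- w]) 0.

Definition tm_action (c : tm_config) :=
  tm_next (tm_cur c) (tm_tape c (tm_pos c)).

Definition tm_step (c : tm_config) : tm_config :=
  if tm_action c is Some (q, a, d) then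
    TmConfig q [eta tm_tape c with tm_pos c |-> a] (move_head d (tm_pos c))
  else c.

Definition decides_in_time (L : seq Sigma -> Prop) (time : nat -> nat) : Prop :=
  forall w, let c := iter (time (size w)) tm_step (tm_init w) in
    tm_action c = None /\ (tm_accept (tm_cur c) <-> L w).

End Machine.

Definition in_P (Sigma : finType) (L : seq Sigma -> Prop) : Prop :=
  exists (M : machine Sigma) (c d : nat),
    decides_in_time M L (fun n => c * n ^ d + c).

(** * Logarithmic-space many-one reductions *)

(* What a head on the read-only input tape sees: the input is surrounded by
   end markers, beyond which the head cannot move. *)
Inductive scanned (Sigma : Type) := LeftEnd | Cell of Sigma | RightEnd.
Arguments LeftEnd {Sigma}.
Arguments RightEnd {Sigma}.

Definition scan (Sigma : Type) (w : seq Sigma) (p : nat) : scanned Sigma :=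
  if p is q.+1 then nth RightEnd [seq Cell a | a <- w] q else LeftEnd.

(* Deterministic transducers with a read-only input tape, [td_tapes] work
   tapes and a write-only output tape, to which each step appends at most one
   symbol. *)
Record transducer (Sigma Gamma : finType) := Transducer {
  td_tapes : nat;
  td_state : finType;
  td_work : finType;
  td_start : td_state;
  td_next : td_state -> scanned Sigma -> {ffun 'I_td_tapes -> option td_work} ->
              option (td_state * move * ('I_td_tapes -> option td_work * move)
                      * option Gamma) }.

Section Transducer.
Variables (Sigma Gamma : finType) (M : transducer Sigma Gamma).

Record td_config := TdConfig {
  td_cur : td_state M;
  td_inpos : nat;
  td_tape : 'I_(td_tapes M) -> nat -> option (td_work M);
  td_pos : 'I_(td_tapes M) -> nat;
  td_out : seq Gamma }.

(* The input head starts on the first input symbol. *)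
Definition td_init : td_config :=
  TdConfig (td_start M) 1 (fun _ _ => None) (fun _ => 0) [::].

Definition td_action (w : seq Sigma) (c : td_config) :=
  td_next (td_cur c) (scan w (td_inpos c))
    [ffun i => td_tape c i (td_pos c i)].

Definition td_step (w : seq Sigma) (c : td_config) : td_config :=
  if td_action w c is Some (q, d, act, o) then
    TdConfig q (minn (move_head d (td_inpos c)) (size w).+1)
      (fun i => [eta td_tape c i with td_pos c i |-> (act i).1])
      (fun i => move_head (act i).2 (td_pos c i))
      (if o is Some b then rcons (td_out c) b else td_out c)
  else c.

Definition computes_in_space (f : seq Sigma -> seq Gamma) (space : nat -> nat) :
    Prop :=
  forall w,
    (exists t, let c := iter t (td_step w) td_init in
       td_action w c = None /\ td_out c = f w) /\
    (forall t i, td_pos (iter t (td_step w) td_init) i < space (size w)).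

End Transducer.

Definition logspace_computable (Sigma Gamma : finType)
    (f : seq Sigma -> seq Gamma) : Prop :=
  exists (M : transducer Sigma Gamma) (c : nat),
    computes_in_space M f (fun n => c * trunc_log 2 n + c).

Definition logspace_reducible (Sigma Gamma : finType)
    (L : seq Sigma -> Prop) (K : seq Gamma -> Prop) : Prop :=
  exists2 f : seq Sigma -> seq Gamma,
    logspace_computable f & forall w, L w <-> K (f w).

Definition P_hard (Gamma : finType) (K : seq Gamma -> Prop) : Prop :=
  forall (Sigma : finType) (L : seq Sigma -> Prop),
    in_P L -> logspace_reducible L K.

(* Main.v *)
(** The game simulates Horn clauses with strict dominance.  Rows are atoms and
    clauses; each atom has an elimination column and a selector column.  A
    clause row beats the row of an atom in its head everywhere except on the
    elimination columns of its body, and the elimination column of an atom is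
    beaten by any selector column once the row of that atom is gone; so a row
    is eliminable iff its atom is derivable, and payoffs 0, 1, 2 suffice.  The
    computation of a machine running in time less than T is described by Horn
    clauses indexed by pairs (time, position) below T, where T is a power
    K^W with W the number of binary digits of the input length.

    The transducer writing down this game keeps five W-digit counters on a
    single work tape, one tape cell holding one digit of each counter.  A sweep
    to the right increments some counters and compares all of them, after which
    the finite control decides what to print and which counters come next; the
    printing program is then a nest of loops over these counters. *)
From HB Require Import structures.
From mathcomp Require Import all_boot all_order all_algebra.
From mathcomp Require Import boolp reals.
From mathcomp Require Import zify.
Require Import Defs.
Set Implicit Arguments.
Unset Strict Implicit.
Unset Printing Implicit Defensive.
Import Order.TTheory GRing.Theory Num.Theory.

(** * Horn clauses as games *)

Section HornGame.
Variables (P : eqType) (Q : Type) (hd bd : Q -> P -> bool) (rule : Q -> Prop).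

Inductive derivable (x : P) : Prop :=
  Derive r of rule r & hd r x & (forall y, bd r y -> derivable y).

Definition payoffA (i : P + Q) (j : P + P) : nat :=
  match i, j with
  | inl _, inl _ => 0
  | inl x, inr y => x == y
  | inr r, inl y => ~~ bd r y
  | inr r, inr y => (hd r y).+1
  end.

Definition payoffB (i : P + Q) (j : P + P) : nat :=
  match i, j with
  | inl x, inl y => x == y
  | inr _, inl _ => 0
  | _, inr _ => 1
  end.

Variables (R : realType) (n m : nat) (row : 'I_n -> P + Q) (col : 'I_m -> P + P).
Variables (A B : 'M[R]_(n, m)).
Hypothesis AE : forall i j, A i j = (payoffA (row i) (col j))%:R%R.
Hypothesis BE : forall i j, B i j = (payoffB (row i) (col j))%:R%R.
Hypothesis row_rule : forall r, rule r <-> exists i, row i = inr r.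
Hypothesis col_sel : forall i x, row i = inl x -> exists j, col j = inr x.
Hypothesis col_body : forall r y, rule r -> bd r y -> exists j, col j = inl y.

Hypothesis row_elim : forall j x, col j = inl x -> exists i, row i = inl x.

(** Clause rows may disappear as well, so nothing is claimed about them. A surviving row is recorded
    because it is what keeps selector columns from being dominated. *)
Let sound (S : {set 'I_n} * {set 'I_m}) :=
  [/\ forall i x, row i = inl x -> i \notin S.1 -> derivable x,
      forall j x, col j = inl x -> j \notin S.2 -> derivable x,
      forall j x, col j = inr x -> j \in S.2
    & exists i, i \in S.1].

Lemma payoffB_le1 i j : payoffB i j <= 1.
Proof. by case: i j => [x|r] [y|y] //=; case: (_ == _). Qed.

Lemma sound_step j' x' S T : col j' = inr x' ->
  sound S -> strict_step A B S T -> sound T.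
Proof.
move=> Ej' [s1 s2 s3 [i1 i1S]].
case/orP=> [/existsP[i /andP[/eqP-> /existsP[i0 /andP[i0S /forallP dom]]]]
           |/existsP[j /andP[/eqP-> /existsP[j0 /andP[j0S /forallP dom]]]]].
- split=> //=.
  + move=> i' x Ei; rewrite !inE negb_and negbK => /orP[/eqP E|]; last exact: s1 Ei.
    subst i'; have [j Ej] := col_sel Ei.
    (* The row of [x] earns 1 on its own selector column, so the dominating row earns 2 there and
       must be a clause with head [x]. *)
    have:= dom j; rewrite (s3 _ _ Ej) /= !AE ltr_nat Ei Ej /= eqxx.
    case E0: (row i0) => [y|r] /=; first by case: (_ == _).
    rewrite ltnS lt0b => hr.
    have Rr : rule r by apply/row_rule; exists i0.
    apply: (Derive Rr hr) => y by_; have [k Ek] := col_body Rr by_.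
    (* A surviving elimination column of a body atom would leave the clause row with payoff 0, which
       dominates nothing. *)
    apply: (s2 _ _ Ek); apply/negP => kS.
    by have := dom k; rewrite kS /= !AE ltr_nat Ei Ek E0 /= by_.
  (* The selector column [j'] rules out that a row dominates itself over an empty set of columns. *)
  exists i0; rewrite !inE i0S andbT; apply/eqP => E; subst i0.
  by have := dom j'; rewrite (s3 _ _ Ej') ltxx.
split=> //=.
- move=> k x Ek; rewrite !inE negb_and negbK => /orP[/eqP E|]; last exact: s2 Ek.
  (* While the row of [x] survives, this column earns there the maximum 1 of [payoffB]. *)
  subst k; have [i Ei] := row_elim Ek; apply: (s1 _ _ Ei); apply/negP => iS.
  have := dom i; rewrite iS !BE ltr_nat Ei Ek implyTb ltnNge.
  by rewrite (leq_trans (payoffB_le1 _ _)) //= eqxx.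
- move=> k x Ek; rewrite !inE (s3 _ _ Ek) andbT; apply/eqP => E; subst k.
  (* A selector column earns the maximum on every row, so any surviving row blocks its
     elimination. *)
  have := dom i1; rewrite i1S !BE ltr_nat Ek implyTb ltnNge.
  by rewrite (leq_trans (payoffB_le1 _ _)) //; case: (row i1).
by exists i1.
Qed.

Let good (S : {set 'I_n} * {set 'I_m}) :=
  [&& connect (strict_step A B) ([set: 'I_n], [set: 'I_m]) S,
      [forall i, (if row i is inr _ then true else false) ==> (i \in S.1)]
    & [forall j, (if col j is inr _ then true else false) ==> (j \in S.2)]].

(** Induction on the derivation: once the elimination columns of the body are gone, the clause row
    dominates the row of its head, and once that row is gone a selector column dominates its
    elimination column. Minimality spares the explicit construction of an elimination sequence. *)
Lemma good_min_derivable S x : good S ->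
    (forall T, good T -> #|S.1| + #|S.2| <= #|T.1| + #|T.2|) -> derivable x ->
  (forall i, row i = inl x -> i \notin S.1)
  /\ (forall j, col j = inl x -> j \notin S.2).
Proof.
move=> /and3P[cS /forallP rS /forallP lS] minS; elim=> {}x r Rr hr _ IH.
have row_out i : row i = inl x -> i \notin S.1.
  move=> Ei; apply/negP => iS.
  suff /minS : good (S.1 :\ i, S.2) by rewrite (cardsD1 i S.1) iS /= leq_add2r ltnn.
  have [i0 E0] := (row_rule r).1 Rr.
  apply/and3P; split=> /=; last exact/forallP; last first.
    apply/forallP => k; rewrite !inE; have := rS k; case: eqP => [->|_ //=].
    by rewrite Ei.
  apply: connect_trans cS (connect1 _).
  apply/orP; left; apply/existsP; exists i; rewrite eqxx /=.
  apply/existsP; exists i0; have := rS i0; rewrite E0 /= => -> /=.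
  apply/forallP => j; apply/implyP => jS; rewrite !AE ltr_nat E0 Ei /=.
  case Ej: (col j) => [y|y] /=; last by rewrite ltnS; case: eqP => // <-; rewrite hr.
  rewrite lt0b; apply/negP => by_; have [_ /(_ j Ej)] := IH y by_.
  by rewrite jS.
split=> // j Ej; apply/negP => jS.
suff /minS : good (S.1, S.2 :\ j) by rewrite (cardsD1 j S.2) jS /= leq_add2l ltnn.
have [i Ei] := row_elim Ej; have [j0 E0] := col_sel Ei.
apply/and3P; split=> /=; first 1 last.
- exact/forallP.
- apply/forallP => k; rewrite !inE; have := lS k; case: eqP => [->|_ //=].
  by rewrite Ej.
apply: connect_trans cS (connect1 _).
apply/orP; right; apply/existsP; exists j; rewrite eqxx /=.
apply/existsP; exists j0; have := lS j0; rewrite E0 /= => -> /=.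
apply/forallP => k; apply/implyP => kS; rewrite !BE ltr_nat E0 Ej /=.
case Ek: (row k) => [y|y] //=; rewrite ltnS leqn0 eqb0.
by apply/eqP => E; subst y; move: (row_out k Ek); rewrite kS.
Qed.

Theorem strict_derivable i x : row i = inl x -> strict A B i <-> derivable x.
Proof.
move=> Ei; have [j' Ej'] := col_sel Ei; split.
  case=> S /connectP[p pth ->].
  suff H U : sound U -> path (strict_step A B) U p -> i \notin (last U p).1 ->
      derivable x.
    by apply: H pth; split=> [? ? ?|? ? ?|? ? _|]; rewrite ?inE //;
      exists i; rewrite inE.
  elim: p U {pth} => [|T p IH] U sU /=; first by move=> _; case: sU => /(_ _ _ Ei).
  by move=> /andP[/(sound_step Ej' sU) sT]; apply: IH.
move=> dx; have g0 : good ([set: 'I_n], [set: 'I_m]).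
  by apply/and3P; split=> //; apply/forallP => k; rewrite inE implybT.
have [S gS minS] := arg_minnP (fun S : {set 'I_n} * {set 'I_m} => #|S.1| + #|S.2|) g0.
exists S; first by case/and3P: gS.
by have [/(_ _ Ei)] := good_min_derivable gS minS dx.
Qed.

End HornGame.

(** * Turing machine computations as Horn clauses *)

Section Tableau.
Variables (Sigma : finType) (M : machine Sigma).

Definition cell : Type := option (Sigma + tm_aux M).
HB.instance Definition _ := Finite.on cell.

Definition atom : Type := option (option (tm_state M + cell)).
HB.instance Definition _ := Finite.on atom.
Definition clause : Type := option (tm_state M * cell + cell).
HB.instance Definition _ := Finite.on clause.

Notation Acc := (None : atom).
Notation NoHead := (Some None : atom).
Notation At q := (Some (Some (inl q)) : atom).
Notation Sym a := (Some (Some (inr a)) : atom).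
Notation Fact := (None : clause).
Notation Trans q a := (Some (inl (q, a)) : clause).
Notation Frame a := (Some (inr a) : clause).

(* [heads] and [bodies] relate the clause [d] placed at (t, p) to the atom [g]
   placed at (t', p').  The Booleans stand for t = 0, p = 0, t = t', t + 1 = t',
   p = p', p + 1 = p' and p' + 1 = p.  A clause may have many heads: a
   transition yields [NoHead] at all other positions of its time at once, and
   acceptance at every (t', p'), in particular at (0, 0). *)
Definition heads (d : clause) (g : atom) (a0 : cell)
    (t0 p0 eqt sct eqp scp pcp : bool) : bool :=
  match d with
  | None =>
      match g with
      | Some (Some (inl q)) => [&& t0, p0, eqt, eqp & q == tm_start M]
      | Some (Some (inr a)) => [&& t0, eqt, eqp & a == a0]
      | _ => false
      end
  | Some (inl (q, a)) =>
      if tm_next q a is Some (q', b, mv) then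
        match g with
        | None => false
        | Some None => eqt && ~~ eqp
        | Some (Some (inl q'')) =>
            [&& q'' == q', sct &
              match mv with
              | Left => pcp || p0 && eqp | Stay => eqp | Right => scp
              end]
        | Some (Some (inr b')) => [&& b' == b, sct & eqp]
        end
      else if g is None then tm_accept q else false
  | Some (inr a) =>
      if g is Some (Some (inr a')) then [&& a' == a, sct & eqp] else false
  end.

Definition bodies (d : clause) (g : atom) (eqt eqp : bool) : bool :=
  [&& eqt, eqp &
    match d, g with
    | Some (inl (q, _)), Some (Some (inl q')) => q' == q
    | Some (inl (_, a)), Some (Some (inr a')) => a' == a
    | Some (inr a), Some (Some (inr a')) => a' == a
    | Some (inr _), Some None => true
    | _, _ => false
    end].

Variable w : seq Sigma.

Definition tableau_hd (r : nat * nat * clause) (x : nat * nat * atom) : bool :=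
  heads r.2 x.2 (tm_tape (tm_init M w) r.1.2) (r.1.1 == 0) (r.1.2 == 0)
    (r.1.1 == x.1.1) (r.1.1.+1 == x.1.1)
    (r.1.2 == x.1.2) (r.1.2.+1 == x.1.2) (x.1.2.+1 == r.1.2).

Definition tableau_bd (r : nat * nat * clause) (x : nat * nat * atom) : bool :=
  bodies r.2 x.2 (r.1.1 == x.1.1) (r.1.2 == x.1.2).

Definition in_range T (r : nat * nat * clause) : Prop := (r.1.1 < T) && (r.1.2 < T).

Let conf t := iter t (@tm_step _ M) (tm_init M w).

(** The intended meaning of an atom. Acceptance does not depend on the indices, since its clause has
    it as a head at every time and position. *)
Let holds (x : nat * nat * atom) : Prop :=
  let c := conf x.1.1 in
  match x.2 with
  | None => exists t, tm_action (conf t) = None /\ tm_accept (tm_cur (conf t))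
  | Some None => tm_pos c <> x.1.2
  | Some (Some (inl q)) => tm_cur c = q /\ tm_pos c = x.1.2
  | Some (Some (inr a)) => tm_tape c x.1.2 = a
  end.

Lemma derivable_holds T x :
  derivable tableau_hd tableau_bd (in_range T) x -> holds x.
Proof.
elim=> {}x [[t p] d] _; case: x => [[t' p'] g].
rewrite /tableau_hd /tableau_bd /heads /bodies /=.
case: d => [[[q a]|a]|] /=; last 1 first.
- case: g => [[[q|a]|]|] //=.
    by case/and5P => /eqP-> /eqP-> /eqP<- /eqP<- /eqP->.
  by case/and4P => /eqP-> /eqP<- /eqP<- /eqP->.
- move=> hd _ IH.
  have [cq cp] : holds (t, p, At q) by apply: IH; rewrite /= !eqxx.
  have ca : holds (t, p, Sym a) by apply: IH; rewrite /= !eqxx.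
  rewrite /holds /= in cq cp ca.
  have act : tm_action (conf t) = tm_next q a by rewrite /tm_action cq cp ca.
  have stepE : conf t.+1 = tm_step (conf t) by [].
  case E: (tm_next q a) hd => [[[q' b] mv]|] hd; last first.
    by case: g hd => // acc; exists t; rewrite act E cq.
  rewrite /tm_step act E cp in stepE.
  rewrite /holds; case: g hd => [[[q''|b']|]|] //=.
  + case/and3P => /eqP-> /eqP<-; rewrite stepE /= => hm; split=> //.
    move: hm; case: mv {E stepE} => /=; last by move/eqP.
      by case/orP=> [/eqP<- //|/andP[/eqP-> /eqP<-]].
    by move/eqP.
  + by case/and3P => /eqP-> /eqP<- /eqP<-; rewrite stepE /= eqxx.
  by case/andP => /eqP<- /eqP ne; rewrite cp.
case: g => [[[//|a']|]|] //= /and3P[/eqP-> /eqP<- /eqP<-] _ IH.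
have ca : holds (t, p, Sym a) by apply: IH; rewrite /= !eqxx.
have np : holds (t, p, NoHead) by apply: IH; rewrite /= !eqxx.
rewrite /holds /= in ca np *; rewrite -/(conf t) /tm_step.
(* A step writes only under the head, which [np] places elsewhere; a halted machine writes
   nothing. *)
case: tm_action => [[[q b] mv]|] //=.
by case: eqP => // E; case: np.
Qed.

(** The head moves by at most one cell per step, so it stays among the positions below [T]. [NoHead]
    is left out of the induction: the transition clause at the head gives it for all other positions
    of the same time. *)
Lemma holds_derivable T t : t < T ->
    (forall s, s < t -> tm_action (conf s) <> None) ->
    [/\ tm_pos (conf t) <= t,
      derivable tableau_hd tableau_bd (in_range T)
         (t, tm_pos (conf t), At (tm_cur (conf t)))
    & forall p, p < T -> derivable tableau_hd tableau_bd (in_range T)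
         (t, p, Sym (tm_tape (conf t) p))].
Proof.
elim: t => [|t IH] tT run.
  split=> [//||p pT].
    apply: (@Derive _ _ _ _ _ _ (0, 0, Fact)) => [||[[? ?] ?]].
    - by rewrite /in_range tT.
    - by rewrite /tableau_hd /= !eqxx.
    - by rewrite /tableau_bd /bodies /= !andbF.
  apply: (@Derive _ _ _ _ _ _ (0, p, Fact)) => [||[[? ?] ?]].
  - by rewrite /in_range tT.
  - by rewrite /tableau_hd /= !eqxx.
  - by rewrite /tableau_bd /bodies /= !andbF.
have {IH}[post dq da] := IH (ltnW tT) (fun s st => run s (ltnW st)).
have nh := run t (ltnSn t).
have act : tm_action (conf t) = tm_next (tm_cur (conf t))
  (tm_tape (conf t) (tm_pos (conf t))) by [].
have stepE : conf t.+1 = tm_step (conf t) by [].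
rewrite /tm_step act in stepE; rewrite act in nh.
set p0 := tm_pos (conf t) in post dq act stepE nh *.
set q0 := tm_cur (conf t) in dq act stepE nh *.
set a0 := tm_tape (conf t) p0 in act stepE nh *.
have p0T : p0 < T := leq_ltn_trans post (ltnW tT).
have trans x : tableau_hd (t, p0, Trans q0 a0) x ->
    derivable tableau_hd tableau_bd (in_range T) x.
  move=> hx; apply: (Derive _ hx); first by rewrite /in_range /= p0T ltnW.
  case=> [[t' p'] [[[q|a]|]|]]; rewrite /tableau_bd /bodies /= ?andbF //.
    by case/and3P=> /eqP<- /eqP<- /eqP->.
  by case/and3P=> /eqP<- /eqP<- /eqP->; apply: da.
case E: (tm_next q0 a0) nh stepE => [[[q' b] mv]|] // _ ->; split=> [||p pT] /=.
- by case: mv {E} => /=; lia.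
- apply: trans; rewrite /tableau_hd /= E !eqxx /=.
  by case: mv {E} => /=; rewrite ?eqxx //; case: (p0) => //= n; rewrite eqxx.
- case: eqP => [->|/eqP ne]; first by apply: trans; rewrite /tableau_hd /= E !eqxx.
  apply: (@Derive _ _ _ _ _ _ (t, p, Frame (tm_tape (conf t) p))).
  + by rewrite /in_range /= pT ltnW.
  + by rewrite /tableau_hd /= !eqxx.
  case=> [[t' p'] [[[q|a]|]|]]; rewrite /tableau_bd /bodies /= ?andbF //.
    by case/and3P=> /eqP<- /eqP<- /eqP->; apply: da.
  case/and3P=> /eqP<- /eqP<- _; apply: trans.
  by rewrite /tableau_hd /= E eqxx eq_sym ne.
Qed.

Lemma tableau_derivable (L : seq Sigma -> Prop) time T :
    decides_in_time M L time -> time (size w) < T ->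
  derivable tableau_hd tableau_bd (in_range T) (0, 0, Acc) <-> L w.
Proof.
move=> /(_ w)[]; rewrite -/(conf _); set tau := time _ => halt <- tauT.
have stop t k : tm_action (conf t) = None -> conf (k + t) = conf t.
  move=> E; elim: k => // k IH; rewrite addSn /conf iterS -/(conf _) IH.
  by rewrite /tm_step E.
split=> [/derivable_holds[t [Ht acc]]|acc].
  (* Two halting configurations of one run coincide. *)
  suff <- : conf t = conf tau by [].
  by case: (leqP t tau) => [|/ltnW] /subnK <-; rewrite stop.
pose stopped t := if tm_action (conf t) is None then true else false.
have exh : exists t, stopped t by exists tau; rewrite /stopped halt.
(* The first halting time [h]: no configuration before it halts, as [holds_derivable] requires, and
   none after it differs. *)
case: (ex_minnP exh) => h; rewrite {1}/stopped => hh minh.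
have htau : h <= tau by apply: minh; rewrite /stopped halt.
have hT := leq_ltn_trans htau tauT.
have [|posh dq da] := holds_derivable hT.
  by move=> s sh E; have := minh s; rewrite /stopped E leqNgt sh => /(_ isT).
have pT := leq_ltn_trans posh hT.
have Eh : tm_action (conf h) = None by case: (tm_action _) hh.
apply: (@Derive _ _ _ _ _ _ (h, tm_pos (conf h),
  Trans (tm_cur (conf h)) (tm_tape (conf h) (tm_pos (conf h))))).
- by rewrite /in_range /= pT hT.
- rewrite /tableau_hd /=; move: (Eh); rewrite /tm_action => ->.
  suff <- : conf tau = conf h by [].
  by rewrite -(subnK htau) stop.
case=> [[t' p'] [[[q|a]|]|]]; rewrite /tableau_bd /bodies /= ?andbF //.
  by case/and3P=> /eqP<- /eqP<- /eqP->.
by case/and3P=> /eqP<- /eqP<- /eqP->; apply: da.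
Qed.

End Tableau.

(** * Counter machines in logarithmic space *)

Definition digit (b x k : nat) := x %/ b ^ k %% b.

Lemma digit_inj b W x y : x < b ^ W -> y < b ^ W ->
  (forall k, k < W -> digit b x k = digit b y k) -> x = y.
Proof.
elim: W x y => [|W IH] x y xW yW E; first by case: x y xW yW {E} => [|?] [].
case: b IH xW yW E => [|b] IH xW yW E; first by rewrite exp0n in xW.
have hi : x %/ b.+1 = y %/ b.+1.
  apply: IH; rewrite ?ltn_divLR -?expnSr // => k kW.
  by have := E k.+1 kW; rewrite /digit expnS !divnMA.
have := E 0 isT; rewrite /digit !divn1 => lo.
by rewrite (divn_eq x b.+1) (divn_eq y b.+1) hi lo.
Qed.

(** The carry into digit [k], when 1 is added to [x], is 1 exactly if [b ^ k] divides [x.+1]. The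
    next lemma propagates this carry. *)
Lemma digitS b x k : 0 < b ->
  digit b x.+1 k = ((b ^ k %| x.+1) + digit b x k) %% b.
Proof. by move=> b0; rewrite /digit divnS ?expn_gt0 ?b0 // modnDmr. Qed.

Lemma dvdn_expSE b x k : 0 < b ->
  (b ^ k.+1 %| x) = (b ^ k %| x) && (digit b x k == 0).
Proof.
move=> b0; have bk : 0 < b ^ k by rewrite expn_gt0 b0.
case: (boolP (b ^ k %| x)) => [/dvdnP[y ->]|nd] /=.
  by rewrite /digit mulnK // expnSr [y * _]mulnC dvdn_pmul2l.
apply: contraNF nd; apply: dvdn_trans; by rewrite expnS dvdn_mull.
Qed.

Lemma digit_small b x k : x < b ^ k -> digit b x k = 0.
Proof. by move=> lt; rewrite /digit divn_small // mod0n. Qed.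

(** An overflowing counter thus has the same [W] digits as 0. *)
Lemma digit_exp b W k : k < W -> digit b (b ^ W) k = 0.
Proof.
case: b => [|b] kW; first by rewrite /digit exp0n ?div0n //; case: W kW.
rewrite /digit -(subnK (ltnW kW)) expnD mulnK ?expn_gt0 //.
by rewrite -(subnKC (_ : 0 < W - k)) ?subn_gt0 // expnS modnMr.
Qed.

Lemma digit0 b k : digit b 0 k = 0.
Proof. by rewrite /digit div0n mod0n. Qed.

(** * Space-bounded runs of transducers *)

Section Reach.
Variables (Sigma Gamma : finType) (M : transducer Sigma Gamma) (w : seq Sigma).

Definition reach S (c c' : td_config M) :=
  exists2 t, iter t (td_step w) c = c' &
    forall s, s <= t -> forall i, td_pos (iter s (td_step w) c) i < S.

Lemma reach_trans S c2 c1 c3 : reach S c1 c2 -> reach S c2 c3 -> reach S c1 c3.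
Proof.
move=> [t1 E1 H1] [t2 E2 H2]; exists (t2 + t1); first by rewrite iterD E1.
move=> s st; case: (leqP s t1) => [/H1//|/ltnW s1].
by rewrite -(subnK s1) iterD E1; apply: H2; rewrite leq_subLR addnC.
Qed.

Lemma reach_refl S c : (forall i, td_pos c i < S) -> reach S c c.
Proof. by move=> H; exists 0 => // s; rewrite leqn0 => /eqP->. Qed.

End Reach.

(** A halting configuration is a fixed point of the step function, so the space bound along the
    finite run extends to all times. *)
Lemma reach_logspace Sigma Gamma (M : transducer Sigma Gamma)
    (f : seq Sigma -> seq Gamma) c :
  (forall w, exists2 cf, reach w (c * trunc_log 2 (size w) + c) (td_init M) cf
     & td_action w cf = None /\ td_out cf = f w) ->
  logspace_computable f.
Proof.
move=> H; exists M, c => w; have [cf [t Et Ht] [Ha Ho]] := H w.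
split=> [|s i]; first by exists t; rewrite /= Et.
have stop k : iter k (td_step w) cf = cf.
  by elim: k => //= k ->; rewrite /td_step Ha.
case: (leqP s t) => [/Ht//|/ltnW/subnK <-].
by rewrite iterD Et stop -Et; apply: Ht.
Qed.

(** * Counters on a single work tape *)

Section CounterMachine.
Variables (Sigma Gamma : finType) (r D L : nat) (base : 'I_r -> nat).
Hypotheses (base_gt0 : forall i, 0 < base i) (base_le : forall i, base i <= D.+1).

Let digits := {ffun 'I_r -> 'I_D.+1}.

(* Components: [x i + 1 = base i ^ W], [x i = 0], [x i = x j], [x i + 1 = x j]
   (the last two for counters in the same base), where [x] are the counters and
   [W] is their width; during a sweep they refer
   to the digits read so far, the first being the carry of [x i + 1]. *)
Definition flags : Type := ({ffun 'I_r -> bool} * {ffun 'I_r -> bool}) *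
               ({ffun 'I_r * 'I_r -> bool} * {ffun 'I_r * 'I_r -> bool}).
HB.instance Definition _ := Finite.on flags.

Variables (Q : finType) (q0 : Q) (inc : Q -> pred 'I_r).
Variable next : Q -> flags -> scanned Sigma ->
  option (Q * bool * move * L.-bseq Gamma).

(** The flags for an empty prefix of digits: the carry is the 1 to be added, and counters in
    different bases never match. *)
Definition flags0 : flags :=
  (([ffun=> true], [ffun=> true]),
   ([ffun ij => base ij.1 == base ij.2], [ffun ij => base ij.1 == base ij.2])).

Definition inc_digit (f : flags) (c : digits) i := (f.1.1 i + c i) %% base i.

Definition flags_next (f : flags) (c : digits) : flags :=
  (([ffun i => f.1.1 i && (inc_digit f c i == 0)],
    [ffun i => f.1.2 i && (c i == 0 :> nat)]),
   ([ffun ij => f.2.1 ij && (c ij.1 == c ij.2)],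
    [ffun ij => f.2.2 ij && (inc_digit f c ij.1 == c ij.2)])).

(** A final carry means that [x i + 1] has overflowed to digits all equal to 0, which would wrongly
    match a zero counter. *)
Definition flags_end (f : flags) : flags :=
  (f.1, (f.2.1, [ffun ij => f.2.2 ij && ~~ f.1.1 ij.1])).

Definition write (q : Q) (f : flags) (c : digits) : digits :=
  [ffun i => if inc q i then inord (inc_digit f c i) else c i].

(** The states are the initial one, which writes the end marker, the sweep to the right with the
    flags read so far, and the return to the marker with the output still to be printed. The Boolean
    [e] appends a zero digit to the tape. *)
Definition cm_next (s : unit + Q * flags + Q * L.-bseq Gamma) (a : scanned Sigma)
    (rd : {ffun 'I_1 -> option (option digits)}) :
    option ((unit + Q * flags + Q * L.-bseq Gamma) * move *
            ('I_1 -> option (option digits) * move) * option Gamma) :=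
  match s with
  | inl (inl _) =>
      Some (inl (inr (q0, flags0)), Stay, fun=> (Some None, Right), None)
  | inl (inr (q, f)) =>
      if rd ord0 is Some (Some c) then
        Some (inl (inr (q, flags_next f c)), Stay,
              fun=> (Some (Some (write q f c)), Right), None)
      else if next q (flags_end f) a is Some (q', e, mv, o) then
        Some (inr (q', o), mv,
              fun=> (if e then Some (Some [ffun=> ord0]) else None, Left), None)
      else None
  | inr (q, o) =>
      if rd ord0 is Some None then
        if bseqval o is a :: _ then
          Some (inr (q, widen_bseq (leq_pred L) [bseq of behead o]), Stay,
                fun=> (Some None, Stay), Some a)
        else Some (inl (inr (q, flags0)), Stay, fun=> (Some None, Right), None)
      else Some (inr (q, o), Stay, fun=> (rd ord0, Left), None)
  end.

Definition cm_transducer : transducer Sigma Gamma :=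
  @Transducer Sigma Gamma 1 _ (option digits) (inl (inl tt)) cm_next.

Section Run.
Variable w : seq Sigma.

Definition config s ip tp pos out : td_config cm_transducer :=
  @TdConfig Sigma Gamma cm_transducer s ip (fun=> tp) (fun=> pos) out.

Lemma reach_step S s ip tp pos out q d act o :
    pos < S -> ip <= (size w).+1 ->
    cm_next s (scan w ip) [ffun=> tp pos] = Some (q, d, act, o) ->
    move_head (act ord0).2 pos < S ->
  reach w S (config s ip tp pos out)
    (config q (minn (move_head d ip) (size w).+1)
       [eta tp with pos |-> (act ord0).1] (move_head (act ord0).2 pos)
       (if o is Some b then rcons out b else out)).
Proof.
move=> pS ipw E pS'; exists 1.
  rewrite /= /td_step /td_action /= E /config.
  by congr TdConfig; apply: funext => i; rewrite (ord1 i).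
case=> [|[|//]] _ i //=; rewrite /td_step /td_action /= E /=.
by rewrite (ord1 i).
Qed.

Definition digits_of (x : 'I_r -> nat) k : digits :=
  [ffun i => inord (digit (base i) (x i) k)].

(* Cell 0 holds a left end marker; digits come least significant first, so that
   a wider tape represents the same counters. *)
Definition tape W x : nat -> option (option digits) :=
  fun k => if k is k'.+1 then if k' < W then Some (Some (digits_of x k')) else None
           else Some None.

Definition bump W (p : pred 'I_r) (x : 'I_r -> nat) i :=
  if p i then if (x i).+1 == base i ^ W then 0 else (x i).+1 else x i.

(** The flags after the [k] lowest digits have been read. *)
Definition flags_at (x : 'I_r -> nat) k : flags :=
  (([ffun i => base i ^ k %| (x i).+1],
    [ffun i => all (fun l => digit (base i) (x i) l == 0) (iota 0 k)]),
   ([ffun ij => (base ij.1 == base ij.2) &&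
       all (fun l => digit (base ij.1) (x ij.1) l == digit (base ij.2) (x ij.2) l)
         (iota 0 k)],
    [ffun ij => (base ij.1 == base ij.2) &&
       all (fun l => digit (base ij.1) (x ij.1).+1 l == digit (base ij.2) (x ij.2) l)
         (iota 0 k)])).

Definition obs W (x : 'I_r -> nat) : flags :=
  (([ffun i => (x i).+1 == base i ^ W], [ffun i => x i == 0]),
   ([ffun ij => (base ij.1 == base ij.2) && (x ij.1 == x ij.2)],
    [ffun ij => (base ij.1 == base ij.2) && ((x ij.1).+1 == x ij.2)])).

Lemma digits_ofE x k i : digits_of x k i = digit (base i) (x i) k :> nat.
Proof.
rewrite ffunE inordK //; apply: leq_trans (base_le i).
by rewrite ltn_mod base_gt0.
Qed.

Lemma flags_at0 x : flags_at x 0 = flags0.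
Proof.
by congr ((_, _), (_, _)); apply/ffunP => i; rewrite !ffunE ?dvd1n //= andbT.
Qed.

Lemma inc_digitE x k i :
  inc_digit (flags_at x k) (digits_of x k) i = digit (base i) (x i).+1 k.
Proof. by rewrite /inc_digit digits_ofE ffunE digitS. Qed.

Lemma flags_nextE x k : flags_next (flags_at x k) (digits_of x k) = flags_at x k.+1.
Proof.
have allS (p : pred nat) : all p (iota 0 k.+1) = all p (iota 0 k) && p k.
  by rewrite -addn1 iotaD all_cat /= andbT.
congr ((_, _), (_, _)); apply/ffunP => i;
  rewrite [LHS]ffunE [RHS]ffunE ?inc_digitE ?allS /=.
- by rewrite ffunE dvdn_expSE.
- by rewrite ffunE digits_ofE.
- by rewrite ffunE andbA -val_eqE /= !digits_ofE.
- by rewrite ffunE andbA digits_ofE.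
Qed.

Lemma dvdn_max b W x : x < b ^ W -> (b ^ W %| x.+1) = (x.+1 == b ^ W).
Proof.
move=> lt; apply/idP/eqP => [/dvdn_leq|->]; last exact: dvdnn.
by move=> /(_ isT) ge; apply/eqP; rewrite eqn_leq lt.
Qed.

Lemma flags_endE W x : (forall i, x i < base i ^ W) ->
  flags_end (flags_at x W) = obs W x.
Proof.
move=> xW.
have eqd b y z : y < b ^ W -> z < b ^ W ->
    all (fun l => digit b y l == digit b z l) (iota 0 W) = (y == z).
  move=> yW zW; apply/allP/eqP => [H|-> //]; apply: (digit_inj yW zW) => k kW.
  by apply/eqP/H; rewrite mem_iota.
congr ((_, _), (_, _)); apply/ffunP => i; rewrite !ffunE /=.
- exact: dvdn_max.
- rewrite -(eqd (base i)) ?expn_gt0 ?base_gt0 //.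
  by apply: eq_all => l /=; rewrite digit0.
- by case: eqP => //= E; rewrite E eqd // -E.
rewrite dvdn_max //; case: eqP => //= E; case: eqP => /= [E'|/eqP ne].
  by rewrite andbF; apply/esym/negbTE; rewrite E' neq_ltn E xW orbT.
by rewrite andbT E eqd // -E ltn_neqAle ne xW.
Qed.

Lemma writeE W q x k : (forall i, x i < base i ^ W) -> k < W ->
  write q (flags_at x k) (digits_of x k) = digits_of (bump W (inc q) x) k.
Proof.
move=> xW kW; apply/ffunP => i; rewrite !ffunE /bump; case: ifP => // _.
rewrite inc_digitE; case: eqP => // ->; by rewrite digit_exp // digit0.
Qed.

Lemma bump_lt W p x : (forall i, x i < base i ^ W) ->
  forall i, bump W p x i < base i ^ W.
Proof.
move=> xW i; rewrite /bump; case: ifP => // _; case: eqP => [_|/eqP ne].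
  by rewrite expn_gt0 base_gt0.
by rewrite ltn_neqAle ne xW.
Qed.

Lemma bump_none W p x : (forall i, ~~ p i) -> bump W p x = x.
Proof. by move=> H; apply: funext => i; rewrite /bump (negbTE (H i)). Qed.

Lemma tape_ext W x : (forall i, x i < base i ^ W) ->
  ([eta tape W x with W.+1 |-> Some (Some [ffun=> ord0])] : nat -> _) = tape W.+1 x.
Proof.
move=> xW; apply: funext => k /=; case: eqP => [->|/eqP ne].
  rewrite /tape ltnSn; congr (Some (Some _)); apply/ffunP => i.
  by apply: val_inj => /=; rewrite [RHS]digits_ofE ffunE digit_small.
case: k ne => //= k ne; rewrite [k < W.+1]ltnS [k <= W]leq_eqVlt.
by move: ne; rewrite eqSS => /negbTE->.
Qed.

Definition enc q W x ip out := config (inl (inr (q, flags0))) ip (tape W x) 1 out.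

Section Step.
Variables (S W : nat) (x : 'I_r -> nat) (ip : nat).
Hypotheses (xW : forall i, x i < base i ^ W) (WS : W.+1 < S)
  (ipw : ip <= (size w).+1).

Lemma sweep_right q out : reach w S (enc q W x ip out)
  (config (inl (inr (q, flags_at x W))) ip (tape W (bump W (inc q) x)) W.+1 out).
Proof.
pose x' := bump W (inc q) x.
(* In mid-sweep, the cells up to [k] hold the incremented counters and the others the old ones; each
   digit enters the flags before it is overwritten. *)
suff H k : k <= W -> reach w S (enc q W x ip out)
  (config (inl (inr (q, flags_at x k))) ip
     (fun l => if l <= k then tape W x' l else tape W x l) k.+1 out).
  rewrite -/x'; have <- : (fun l => if l <= W then tape W x' l else tape W x l) =
    tape W x' by apply: funext => -[|l] //=; case: ifP => ->.
  exact: H (leqnn W).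
elim: k => [_|k IH kW].
  rewrite flags_at0 /enc.
  have -> : (fun l => if l <= 0 then tape W x' l else tape W x l) = tape W x
    by apply: funext => -[].
  by apply: reach_refl => i /=; lia.
apply: reach_trans (IH (ltnW kW)) _.
have E : (fun l => if l <= k then tape W x' l else tape W x l) k.+1 =
    Some (Some (digits_of x k)) by rewrite ltnn /= kW.
have := @reach_step S (inl (inr (q, flags_at x k))) ip
  (fun l => if l <= k then tape W x' l else tape W x l) k.+1 out.
rewrite /= {1}E ffunE => /(_ _ _ _ _ _ _ erefl) /=.
rewrite (writeE q xW kW) flags_nextE (minn_idPl ipw) -/x'.
have -> : ([eta fun l => if l <= k then tape W x' l else tape W x l with
    k.+1 |-> Some (Some (digits_of x' k))] : nat -> _) =
  (fun l => if l <= k.+1 then tape W x' l else tape W x l).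
  apply: funext => l /=; case: eqP => [->|/eqP ne]; first by rewrite leqnn /= kW.
  by rewrite [l <= k.+1]leq_eqVlt (negbTE ne).
by apply; lia.
Qed.


Lemma sweep_left q o out k : k <= W -> reach w S
  (config (inr (q, o)) ip (tape W x) k out)
  (config (inr (q, o)) ip (tape W x) 0 out).
Proof.
elim: k => [_|k IH kW]; first by apply: reach_refl => i /=; lia.
apply: reach_trans (IH (ltnW kW)).
have := @reach_step S (inr (q, o)) ip (tape W x) k.+1 out.
rewrite /= ffunE /= kW => /(_ _ _ _ _ _ _ erefl) /=.
rewrite (minn_idPl ipw).
have -> : ([eta tape W x with k.+1 |-> Some (Some (digits_of x k))] : nat -> _) =
  tape W x by apply: funext => l /=; case: eqP => // ->; rewrite /= kW.
by apply; lia.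
Qed.

Lemma emit q o out : reach w S
  (config (inr (q, o)) ip (tape W x) 0 out) (enc q W x ip (out ++ o)).
Proof.
have marker : ([eta tape W x with 0 |-> Some None] : nat -> _) = tape W x.
  by apply: funext => -[].
case: o => o; elim: o out => [|a o IH] out szo.
  have := @reach_step S (inr (q, Bseq szo)) ip (tape W x) 0 out.
  rewrite /= ffunE /= => /(_ _ _ _ _ _ _ erefl) /=.
  by rewrite (minn_idPl ipw) marker cats0; apply; lia.
have := @reach_step S (inr (q, Bseq szo)) ip (tape W x) 0 out.
rewrite /= ffunE /= => /(_ _ _ _ _ _ _ erefl) /=.
rewrite (minn_idPl ipw) marker => H; apply: reach_trans (H _ _ _) _; try lia.
have szo' := ltnW szo; have := IH (rcons out a) szo'; rewrite cat_rcons.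
by congr (reach w S (config (inr (q, _)) _ _ _ _) _); apply: val_inj.
Qed.

End Step.

Section MacroStep.
Variables (S W : nat) (x : 'I_r -> nat) (ip : nat).
Hypotheses (xW : forall i, x i < base i ^ W) (WS : W.+1 < S)
  (ipw : ip <= (size w).+1).

(** The control sees the counters as they were before the increments, so a selected counter flagged
    as full is one that this very step resets to 0. *)
Lemma enc_step q q' (e : bool) mv (o : L.-bseq Gamma) out : (W + e).+1 < S ->
    next q (obs W x) (scan w ip) = Some (q', e, mv, o) ->
  reach w S (enc q W x ip out)
    (enc q' (W + e) (bump W (inc q) x) (minn (move_head mv ip) (size w).+1) (out ++ o)).
Proof.
move=> eS E; have x'W := bump_lt (inc q) xW.
apply: reach_trans (sweep_right xW WS ipw q out) _.
set x' := bump W (inc q) x in x'W *.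
have := @reach_step S (inl (inr (q, flags_at x W))) ip (tape W x') W.+1 out.
rewrite /= ffunE /= ltnn flags_endE // E => /(_ _ _ _ _ _ _ erefl) /=.
have -> : ([eta tape W x' with W.+1 |->
    if e then Some (Some [ffun=> ord0]) else None] : nat -> _) = tape (W + e) x'.
  case: e {E eS}; first by rewrite addn1 tape_ext.
  by rewrite addn0; apply: funext => l /=; case: eqP => // ->; rewrite /= ltnn.
move=> H; apply: reach_trans (H _ _ _) _; try lia.
have x''W i : x' i < base i ^ (W + e).
  by rewrite (leq_trans (x'W i)) // leq_pexp2l ?leq_addr.
apply: reach_trans.
  by apply: sweep_left; rewrite ?geq_minr ?leq_addr.
by apply: emit; rewrite ?geq_minr.
Qed.

Lemma enc_halt q out : next q (obs W x) (scan w ip) = None ->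
  exists2 c, reach w S (enc q W x ip out) c & td_action w c = None /\ td_out c = out.
Proof.
move=> E; exists (config (inl (inr (q, flags_at x W))) ip
  (tape W (bump W (inc q) x)) W.+1 out); first exact: sweep_right.
by split=> //; rewrite /td_action /= ffunE /= ltnn flags_endE // E.
Qed.

End MacroStep.

Lemma enc_start S : 1 < S ->
  reach w S (td_init cm_transducer) (enc q0 0 (fun=> 0) 1 [::]).
Proof.
move=> S1; have := @reach_step S (inl (inl tt)) 1 (fun=> None) 0 [::].
rewrite /= => /(_ _ _ _ _ _ _ erefl) /=.
have -> : ([eta fun=> None with 0 |-> Some None] : nat -> _) = tape 0 (fun=> 0).
  by apply: funext => -[].
by rewrite minnSS min0n; apply; lia.
Qed.

End Run.

End CounterMachine.

(** * The program printing the game *)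

Definition loop (F : nat -> seq symbol) N := flatten [seq F k | k <- iota 0 N].

Lemma loopS F N : loop F N.+1 = loop F N ++ F N.
Proof. by rewrite /loop -addn1 iotaD map_cat flatten_cat /= cats0. Qed.

Lemma eq_loop F G N : (forall k, k < N -> F k = G k) -> loop F N = loop G N.
Proof. by move=> E; congr flatten; apply/eq_in_map => k; rewrite mem_iota => /E. Qed.

Lemma loop_mul F m n :
  loop F (m * n) = loop (fun x => loop (fun y => F (x * n + y)) n) m.
Proof.
elim: m => [|m IH]; first by rewrite mul0n.
rewrite loopS -IH mulSnr /loop iotaD map_cat flatten_cat add0n; congr (_ ++ flatten _).
by rewrite -[m * n in LHS]addn0 iotaDl -map_comp.
Qed.

Lemma loop_enum F N : loop F N = flatten [seq F (val i) | i <- enum 'I_N].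
Proof. by rewrite /loop -val_enum_ord -map_comp. Qed.

(** The last iteration leads directly to the exit [D], because the program notices that a counter is
    full in the step that resets it. *)
Lemma reach_loop Sigma (M : transducer Sigma symbol) w S N
    (C : nat -> seq symbol -> td_config M) (D : seq symbol -> td_config M) F :
    0 < N ->
    (forall k out, k < N -> reach w S (C k out)
       (if k.+1 == N then D (out ++ F k) else C k.+1 (out ++ F k))) ->
  forall out, reach w S (C 0 out) (D (out ++ loop F N)).
Proof.
case: N => // N _ step out.
suff H k : k <= N -> reach w S (C 0 out) (C k (out ++ loop F k)).
  have := step N (out ++ loop F N) (ltnSn N).
  by rewrite eqxx -catA -loopS; apply: reach_trans (H N (leqnn N)).
elim: k => [_|k IH kN]; last first.
  have := step k (out ++ loop F k) (ltnW kN).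
  rewrite eqSS ltn_eqF // -catA -loopS; exact: reach_trans (IH (ltnW kN)).
(* The first iteration supplies the space bound at the starting configuration. *)
rewrite cats0; have [t _ H] := step 0 out isT.
by apply: reach_refl => i; apply: (H 0).
Qed.

Inductive stage := Start | Count | Tick | Rewind | Entry | ColPos | ColTime
  | RowEnd | RowPos | RowTime | Stop.

Definition stage_code (s : stage) : 'I_11 :=
  inord match s with
  | Start => 0 | Count => 1 | Tick => 2 | Rewind => 3 | Entry => 4 | ColPos => 5
  | ColTime => 6 | RowEnd => 7 | RowPos => 8 | RowTime => 9 | Stop => 10
  end.
Definition stage_decode (i : 'I_11) : stage :=
  nth Start [:: Start; Count; Tick; Rewind; Entry; ColPos; ColTime;
                RowEnd; RowPos; RowTime; Stop] i.
Lemma stage_codeK : cancel stage_code stage_decode.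
Proof. by case; rewrite /stage_decode inordK. Qed.
HB.instance Definition _ := Finite.copy stage (can_type stage_codeK).

Section Program.
Variables (Sigma : finType) (M : machine Sigma) (c d : nat).

(* Row 0, the query, is acceptance at (0, 0). *)
Definition rkinds : seq (atom M + clause M) :=
  inl None :: rem (inl None) (enum {: atom M + clause M}).
Definition ckinds : seq (atom M + atom M) :=
  inl None :: rem (inl None) (enum {: atom M + atom M}).
Definition rkind k := nth (inl None) rkinds k.
Definition ckind k := nth (inl None) ckinds k.
Let nr := (size rkinds).-1.
Let nc := (size ckinds).-1.

(** Both payoff functions, written in terms of the index comparisons and the input symbol that the
    control can observe; [ph] selects the column player's matrix. *)
Definition entry (ph : bool) (r : atom M + clause M) (s : atom M + atom M)
    (a0 : cell M) (t0 p0 eqt sct eqp scp pcp : bool) : nat :=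
  if ph then
    match r, s with
    | inl g, inl g' => nat_of_bool [&& eqt, eqp & g == g']
    | inr _, inl _ => 0
    | _, inr _ => 1
    end
  else
    match r, s with
    | inl _, inl _ => 0
    | inl g, inr g' => nat_of_bool [&& eqt, eqp & g == g']
    | inr r, inl g => ~~ bodies r g eqt eqp
    | inr r, inr g => (heads r g a0 t0 p0 eqt sct eqp scp pcp).+1
    end.

Lemma entry_lt3 ph r s a0 t0 p0 eqt sct eqp scp pcp :
  entry ph r s a0 t0 p0 eqt sct eqp scp pcp < 3.
Proof.
by rewrite /entry; case: ph r s => -[r|r] [s|s] //; case: (X in nat_of_bool X).
Qed.

Definition payoff_word (v : nat) : seq symbol := rcons (encode_rat v%:R%R) Comma.

(** The longest word is that of 2: two binary digits, the slash, the denominator 1 and the comma. *)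
Lemma size_payoff_word v : v < 3 -> size (payoff_word v) <= 5.
Proof.
rewrite /payoff_word size_rcons /encode_rat pmulrn ltrz0 numq_int denq_int.
by case: v => [|[|[|]]].
Qed.

(* Counter 0 counts the input symbols in binary, which makes the tape
   [trunc_log 2 n + 1] digits wide; with that many digits the others, in base
   [radix], exceed [c * n ^ d + c]. *)
Definition radix := 2 ^ d * (c + c).+2.
Definition base (i : 'I_5) := if i == 0 :> nat then 2 else radix.
Definition width (w : seq Sigma) := (trunc_log 2 (size w)).+1.

Definition regN : 'I_5 := @Ordinal 5 0 isT.
Definition regT : 'I_5 := @Ordinal 5 1 isT.
Definition regP : 'I_5 := @Ordinal 5 2 isT.
Definition regT' : 'I_5 := @Ordinal 5 3 isT.
Definition regP' : 'I_5 := @Ordinal 5 4 isT.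

Definition state : Type := stage * bool * 'I_nr.+1 * 'I_nc.+1.
HB.instance Definition _ := Finite.on state.

Definition incr (q : state) : pred 'I_5 := fun i =>
  match q.1.1.1 with
  | Tick => i == regN | RowTime => i == regT | RowPos => i == regP
  | ColTime => i == regT' | ColPos => i == regP' | _ => false
  end.

Definition cell_of (a : scanned Sigma) : cell M :=
  if a is Cell s then Some (inl s) else None.

Definition entry_at ph r s (o : flags 5) (a : scanned Sigma) : nat :=
  entry ph r s (cell_of a) (o.1.2 regT) (o.1.2 regP)
    (o.2.1 (regT, regT')) (o.2.2 (regT, regT'))
    (o.2.1 (regP, regP')) (o.2.2 (regP, regP')) (o.2.2 (regP', regP)).

(** A word of more than 5 symbols would become empty, hence the size hypotheses of [program_step]
    and [move_step]. *)
Definition say (s : seq symbol) : 5.-bseq symbol := insub_bseq 5 s.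

(** The stages up to [Rewind] measure the input, widening the tape whenever the binary counter is
    full, and print the query 0. The loops that follow run, from the outermost, over the matrix, the
    row's time, position and kind, and the column's time, position and kind; kinds are kept in the
    finite control. *)
Definition program (q : state) (o : flags 5) (a : scanned Sigma) :
    option (state * bool * move * 5.-bseq symbol) :=
  let: (s, ph, rk, ck) := q in
  let full := o.1.1 in
  match s with
  | Start => Some ((Count, ph, rk, ck), true, Stay, say [::])
  | Count =>
      if a is Cell _ then
        if full regN then Some ((Count, ph, rk, ck), true, Stay, say [::])
        else Some ((Tick, ph, rk, ck), false, Stay, say [::])
      else Some ((Rewind, ph, rk, ck), false, Left, say [::])
  | Tick => Some ((Count, ph, rk, ck), false, Right, say [::])
  | Rewind =>
      if a is LeftEnd then
        Some ((Entry, false, inord 0, inord 0), false, Right, say [:: Zero; Bar])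
      else Some ((Rewind, ph, rk, ck), false, Left, say [::])
  | Entry =>
      Some (if ck < nc then (Entry, ph, rk, inord ck.+1) else (ColPos, ph, rk, inord 0),
            false, Stay, say (payoff_word (entry_at ph (rkind rk) (ckind ck) o a)))
  | ColPos =>
      Some ((if full regP' then ColTime else Entry, ph, rk, inord 0),
            false, Stay, say [::])
  | ColTime =>
      Some ((if full regT' then RowEnd else Entry, ph, rk, inord 0),
            false, Stay, say [::])
  | RowEnd =>
      Some (if rk < nr then (Entry, ph, inord rk.+1, inord 0)
            else (RowPos, ph, inord 0, inord 0),
            false, Stay, say [:: Semicolon])
  | RowPos =>
      (* The input head follows the counter [regP]: the rows of time 0 come
         first and then scan the symbol at their position; later rows, for
         which it stays on the right end, ignore it. *)
      Some ((if full regP then RowTime else Entry, ph, inord 0, inord 0),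
            false, Right, say [::])
  | RowTime =>
      if full regT then
        if ph then Some ((Stop, ph, inord 0, inord 0), false, Stay, say [::])
        else Some ((Entry, true, inord 0, inord 0), false, Stay, say [:: Bar])
      else Some ((Entry, ph, inord 0, inord 0), false, Stay, say [::])
  | Stop => None
  end.

Lemma radix_gt1 : 1 < radix.
Proof.
by rewrite /radix; case: (2 ^ d) (expn_gt0 2 d) => // k _; rewrite mulSn ltn_addr.
Qed.

Lemma base_gt0 i : 0 < base i.
Proof. by rewrite /base; case: ifP => // _; apply: ltnW radix_gt1. Qed.

Lemma base_le i : base i <= radix.-1.+1.
Proof.
by rewrite (prednK (ltnW radix_gt1)) /base; case: ifP => // _; exact: radix_gt1.
Qed.

Definition reduction_machine : transducer Sigma symbol :=
  cm_transducer radix.-1 base (Start, false, inord 0, inord 0) incr program.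

(** * Correctness of the printing program *)

Section Word.
Variable w : seq Sigma.
Let n := size w.
Let W := width w.
Definition bound := radix ^ W.
Let T := bound.
(** A sweep ends on cell [W.+1], which is 2 for inputs of length at most 1; hence the additive
    constant 3. *)
Let space := 3 * trunc_log 2 n + 3.

Definition regs k t p t' p' (i : 'I_5) : nat := nth 0 [:: k; t; p; t'; p'] i.

Lemma bound_gt0 : 0 < T.
Proof. by rewrite expn_gt0 (ltnW radix_gt1). Qed.

Definition cfg q V x ip out : td_config reduction_machine :=
  enc radix.-1 base (Start, false, inord 0, inord 0) incr program q V x ip out.

Lemma regs_lt V k t p t' p' : k < 2 ^ V -> t < radix ^ V -> p < radix ^ V ->
  t' < radix ^ V -> p' < radix ^ V -> forall i, regs k t p t' p' i < base i ^ V.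
Proof. by move=> ? ? ? ? ? [[|[|[|[|[|i]]]]] Hi]. Qed.

Lemma program_step q V x ip q' (e : bool) mv s out : (V + e).+1 < space ->
    (forall i, x i < base i ^ V) -> ip <= n.+1 -> size s <= 5 ->
    program q (obs base V x) (scan w ip) = Some (q', e, mv, say s) ->
  reach w space (cfg q V x ip out)
    (cfg q' (V + e) (bump base V (incr q) x) (minn (move_head mv ip) n.+1) (out ++ s)).
Proof.
move=> VS xV ipn sz E.
have -> : s = say s by rewrite /say /insub_bseq insubdK.
apply: (enc_step base_gt0 base_le _ _ xV _ ipn _ _ E) => //.
by apply: leq_ltn_trans VS; rewrite ltnS leq_addr.
Qed.


Lemma width_lt_space : W.+1 < space.
Proof. by rewrite /W /width /space /n; lia. Qed.

Lemma size_lt_width : n < 2 ^ W.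
Proof. exact: trunc_log_ltn. Qed.

Definition printing s ph rk ck t p t' p' ip out :=
  cfg (s, ph, inord rk, inord ck) W (regs n t p t' p') ip out.

Lemma move_step q t p t' p' ip q' mv s out :
    t < T -> p < T -> t' < T -> p' < T -> ip <= n.+1 -> size s <= 5 ->
    program q (obs base W (regs n t p t' p')) (scan w ip) =
      Some (q', false, mv, say s) ->
  reach w space (cfg q W (regs n t p t' p') ip out)
    (cfg q' W (bump base W (incr q) (regs n t p t' p'))
       (minn (move_head mv ip) n.+1) (out ++ s)).
Proof.
move=> tT pT tT' pT' ipn sz E; have := program_step out _ _ ipn sz E.
rewrite addn0; apply; first exact: width_lt_space.
by apply: regs_lt => //; apply: size_lt_width.
Qed.

Lemma cell_of_scan p : cell_of (scan w (minn p.+1 n.+1)) = tm_tape (tm_init M w) p.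
Proof.
rewrite minnSS; case: (ltnP p n) => pn.
  have [a0 _] : exists a0 : Sigma, true.
    by move: pn; rewrite /n; case: (w) => // a; exists a.
  by rewrite /= (nth_map a0) // (nth_map a0).
rewrite /= nth_default ?size_map //.
by rewrite nth_default // size_map.
Qed.

Definition entry_nat ph t p rk t' p' ck :=
  entry ph (rkind rk) (ckind ck) (tm_tape (tm_init M w) p) (t == 0) (p == 0)
    (t == t') (t.+1 == t') (p == p') (p.+1 == p') (p'.+1 == p).

(** The input symbol matters only for the facts at time 0 in the row player's matrix; for all other
    entries the input head may be anywhere. *)
Lemma entry_atE (ph : bool) k t p rk t' p' ck ip :
    (t = 0 -> ip = minn p.+1 n.+1) \/ ph ->
  entry_at ph (rkind rk) (ckind ck) (obs base W (regs k t p t' p')) (scan w ip) =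
  entry_nat ph t p rk t' p' ck.
Proof.
rewrite /entry_at /entry_nat !ffunE /= !eqxx /=.
have [-> [/(_ erefl) ->|->]|tn _] := eqVneq t 0; rewrite ?cell_of_scan //.
Qed.

Section Row.
Variables (ph : bool) (t p rk ip : nat).
Hypotheses (tT : t < T) (pT : p < T) (rk_le : rk <= nr) (ip_le : ip <= n.+1).
Hypothesis ip_ok : (t = 0 -> ip = minn p.+1 n.+1) \/ ph.

Definition kinds_word t' p' :=
  loop (fun ck => payoff_word (entry_nat ph t p rk t' p' ck)) nc.+1.

Lemma kinds_loop t' p' out : t' < T -> p' < T ->
  reach w space (printing Entry ph rk 0 t p t' p' ip out)
    (printing ColPos ph rk 0 t p t' p' ip (out ++ kinds_word t' p')).
Proof.
move=> tT' pT'.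
apply: (reach_loop (C := fun ck out => printing Entry ph rk ck t p t' p' ip out)
  (D := fun out => printing ColPos ph rk 0 t p t' p' ip out)) => // ck {}out ckN.
have := @move_step (Entry, ph, inord rk, inord ck) t p t' p' ip _ Stay
  (payoff_word (entry_nat ph t p rk t' p' ck)) out tT pT tT' pT' ip_le _ _.
rewrite /= !inordK // entry_atE // bump_none // (minn_idPl ip_le) => H.
have {}H := H _ (size_payoff_word (entry_lt3 _ _ _ _ _ _ _ _ _ _ _)) erefl.
rewrite eqSS; move: ckN H; rewrite ltnS; case: (ltngtP ck nc) => //.
Qed.

Definition pos_word t' := loop (kinds_word t') T.

Lemma pos_loop t' out : t' < T ->
  reach w space (printing Entry ph rk 0 t p t' 0 ip out)
    (printing ColTime ph rk 0 t p t' 0 ip (out ++ pos_word t')).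
Proof.
move=> tT'.
apply: (reach_loop (C := fun p' out => printing Entry ph rk 0 t p t' p' ip out)
  (D := fun out => printing ColTime ph rk 0 t p t' 0 ip out)) => [|p' {}out pT'].
  exact: bound_gt0.
apply: reach_trans (kinds_loop out tT' pT') _.
have := @move_step (ColPos, ph, inord rk, inord 0) t p t' p' ip _ Stay
  [::] (out ++ kinds_word t' p') tT pT tT' pT' ip_le _ _.
rewrite /= ffunE (minn_idPl ip_le) cats0 => /(_ _ isT erefl).
have -> : bump base W (incr (ColPos, ph, inord rk, inord 0)) (regs n t p t' p') =
  regs n t p t' (if p'.+1 == T then 0 else p'.+1).
  by apply: funext => -[[|[|[|[|[|i]]]]] Hi].
by rewrite /= -/(bound) -/T; case: eqP.
Qed.

Definition row_word := loop pos_word T.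

Lemma row_loop out :
  reach w space (printing Entry ph rk 0 t p 0 0 ip out)
    (printing RowEnd ph rk 0 t p 0 0 ip (out ++ row_word)).
Proof.
apply: (reach_loop (C := fun t' out => printing Entry ph rk 0 t p t' 0 ip out)
  (D := fun out => printing RowEnd ph rk 0 t p 0 0 ip out)) => [|t' {}out tT'].
  exact: bound_gt0.
apply: reach_trans (pos_loop out tT') _.
have := @move_step (ColTime, ph, inord rk, inord 0) t p t' 0 ip _ Stay
  [::] (out ++ pos_word t') tT pT tT' bound_gt0 ip_le _ _.
rewrite /= ffunE (minn_idPl ip_le) cats0 => /(_ _ isT erefl).
have -> : bump base W (incr (ColTime, ph, inord rk, inord 0)) (regs n t p t' 0) =
  regs n t p (if t'.+1 == T then 0 else t'.+1) 0.
  by apply: funext => -[[|[|[|[|[|i]]]]] Hi].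
by rewrite /= -/(bound) -/T; case: eqP.
Qed.

End Row.

(** Here [s] counts the right moves made by the head since it stood on cell 1; the position itself
    is clamped at the right end marker. *)
Definition ip_at s := minn s.+1 n.+1.

Lemma ip_at_le s : ip_at s <= n.+1.
Proof. exact: geq_minr. Qed.

Lemma ip_atS s : minn (move_head Right (ip_at s)) n.+1 = ip_at s.+1.
Proof. by rewrite /ip_at /=; lia. Qed.

Definition block_word ph t p :=
  loop (fun rk => row_word ph t p rk ++ [:: Semicolon]) nr.+1.

Lemma block_loop (ph : bool) t p s out : t < T -> p < T -> (t = 0 -> s = p) \/ ph ->
  reach w space (printing Entry ph 0 0 t p 0 0 (ip_at s) out)
    (printing RowPos ph 0 0 t p 0 0 (ip_at s) (out ++ block_word ph t p)).
Proof.
move=> tT pT sp.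
apply: (reach_loop (C := fun rk out => printing Entry ph rk 0 t p 0 0 (ip_at s) out)
  (D := fun out => printing RowPos ph 0 0 t p 0 0 (ip_at s) out)) => // rk {}out rkN.
have ok : (t = 0 -> ip_at s = minn p.+1 n.+1) \/ ph.
  by case: sp => [sp|]; [left=> /sp->|right].
apply: reach_trans (row_loop tT pT rkN (ip_at_le s) ok out) _.
have := @move_step (RowEnd, ph, inord rk, inord 0) t p 0 0 (ip_at s) _ Stay
  [:: Semicolon] (out ++ row_word ph t p rk) tT pT bound_gt0 bound_gt0 (ip_at_le s) isT.
rewrite /= inordK // bump_none // (minn_idPl (ip_at_le s)) -catA => /(_ _ erefl).
rewrite eqSS; move: rkN; rewrite ltnS; case: (ltngtP rk nr) => //.
Qed.

Definition time_word ph t := loop (block_word ph t) T.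

Lemma time_loop (ph : bool) t s0 out : t < T -> (t = 0 -> s0 = 0) \/ ph ->
  reach w space (printing Entry ph 0 0 t 0 0 0 (ip_at s0) out)
    (printing RowTime ph 0 0 t 0 0 0 (ip_at (s0 + T)) (out ++ time_word ph t)).
Proof.
move=> tT sp; rewrite -[ip_at s0](congr1 ip_at (addn0 s0)).
apply: (reach_loop
  (C := fun p out => printing Entry ph 0 0 t p 0 0 (ip_at (s0 + p)) out)
  (D := fun out => printing RowTime ph 0 0 t 0 0 0 (ip_at (s0 + T)) out))
  => [|p {}out pT].
  exact: bound_gt0.
apply: (reach_trans (block_loop (ph := ph) (s := s0 + p) out tT pT _)).
  by case: sp => [sp|]; [left=> /sp->|right].
have := @move_step (RowPos, ph, inord 0, inord 0) t p 0 0 (ip_at (s0 + p)) _ Right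
  [::] (out ++ block_word ph t p) tT pT bound_gt0 bound_gt0 (ip_at_le _) isT.
rewrite ip_atS -addnS /= ffunE cats0 => /(_ _ erefl).
have -> : bump base W (incr (RowPos, ph, inord 0, inord 0)) (regs n t p 0 0) =
  regs n t (if p.+1 == T then 0 else p.+1) 0 0.
  by apply: funext => -[[|[|[|[|[|i]]]]] Hi].
by rewrite /= -/(bound) -/T; case: eqP => // ->.
Qed.

Definition matrix_word ph := loop (time_word ph) T.

(** Each time index moves the input head [T] times to the right. Its exact position is needed only
    for time 0 of the first matrix, where it starts on the first cell. *)
Lemma matrix_loop (ph : bool) s0 out : s0 = 0 \/ ph ->
  reach w space (printing Entry ph 0 0 0 0 0 0 (ip_at s0) out)
    (printing (if ph then Stop else Entry) true 0 0 0 0 0 0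
       (ip_at (s0 + T * T))
       (out ++ matrix_word ph ++ if ph then [::] else [:: Bar])).
Proof.
move=> sp; rewrite -[ip_at s0](congr1 ip_at (addn0 s0)) -[s0 + 0]/(s0 + 0 * T) catA.
apply: (reach_loop
  (C := fun t out => printing Entry ph 0 0 t 0 0 0 (ip_at (s0 + t * T)) out)
  (D := fun out => printing (if ph then Stop else Entry) true 0 0 0 0 0 0
       (ip_at (s0 + T * T)) (out ++ if ph then [::] else [:: Bar]))) => [|t {}out tT].
  exact: bound_gt0.
apply: (reach_trans (time_loop (ph := ph) (s0 := s0 + t * T) out tT _)).
  by case: sp => [->|]; [left=> ->|right].
rewrite -addnA -mulSnr.
have := @move_step (RowTime, ph, inord 0, inord 0) t 0 0 0
  (ip_at (s0 + t.+1 * T)) _ Stay (if (t.+1 == T) && ~~ ph then [:: Bar] else [::])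
  (out ++ time_word ph t) tT bound_gt0 bound_gt0 bound_gt0 (ip_at_le _) _.
rewrite (minn_idPl (ip_at_le _)) /= ffunE /= -/(bound) -/T.
have -> : bump base W (incr (RowTime, ph, inord 0, inord 0)) (regs n t 0 0 0) =
  regs n (if t.+1 == T then 0 else t.+1) 0 0 0.
  by apply: funext => -[[|[|[|[|[|i]]]]] Hi].
case: eqP => [->|_] /=; last by rewrite cats0; apply.
by case: ph {sp} => /=; apply.
Qed.

(** The required width grows exactly when the counter is full, which is when [Count] widens the
    tape. Lengths 0 and 1 share width 1, as [trunc_log 2 0] is 0. *)
Lemma widthS k : (trunc_log 2 k.+1).+1 =
  (trunc_log 2 k).+1 + (k.+1 == 2 ^ (trunc_log 2 k).+1).
Proof.
case: k => [|k]; first by [].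
have /andP[lo hi] := trunc_log_bounds (isT : 1 < 2) (isT : 0 < k.+1).
case: eqP => [E|/eqP ne]; first by rewrite E trunc_expnK // addn1.
rewrite addn0; congr _.+1; apply: trunc_log_eq => //.
by rewrite (leq_trans lo) //= ltn_neqAle ne.
Qed.

Let counting s V k := cfg (s, false, inord 0, inord 0) V (regs k 0 0 0 0) k.+1 [::].

Lemma count_loop k : k <= n ->
  reach w space (td_init reduction_machine) (counting Count (trunc_log 2 k).+1 k).
Proof.
elim: k => [_|k IH kn].
  have -> : counting Count (trunc_log 2 0).+1 0 = counting Count (0 + true) 0 by [].
  apply: reach_trans.
    by apply: enc_start; rewrite /space; lia.
  have -> : (fun=> 0) = regs 0 0 0 0 0.
    by apply: funext => -[[|[|[|[|[|i]]]]] Hi].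
  have := @program_step (Start, false, inord 0, inord 0) 0 (regs 0 0 0 0 0) 1
    _ true Stay [::] [::] _ _ isT isT erefl.
  rewrite bump_none // [move_head _ _]/= minnSS min0n.
  by apply; [rewrite /space; lia|apply: regs_lt].
apply: reach_trans (IH (ltnW kn)) _.
have kl : k < 2 ^ (trunc_log 2 k).+1 by apply: trunc_log_ltn.
have rl : (trunc_log 2 k.+1) <= trunc_log 2 n by apply: leq_trunc_log.
have r0 V : 0 < radix ^ V by rewrite expn_gt0 (ltnW radix_gt1).
have scanE : exists a, scan w k.+1 = Cell a.
  have [a0 _] : exists a0 : Sigma, true.
    by move: kn; rewrite /n; case: (w) => // a; exists a.
  by exists (nth a0 w k); rewrite /= (nth_map a0).
have [a Ea] := scanE; have kn' : k.+1 <= n.+1 by apply: ltnW.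
(* Counts one symbol when the width already suffices for [k.+1]; otherwise a widening step comes
   first. *)
have tick V : (trunc_log 2 k.+1).+1 = V -> k.+1 < 2 ^ V ->
    reach w space (counting Count V k) (counting Count V k.+1).
  move=> EV kV; have VS : V.+1 < space by rewrite -EV /space; lia.
  have kV' : k < 2 ^ V by apply: ltnW.
  have := @program_step (Count, false, inord 0, inord 0) V (regs k 0 0 0 0) k.+1
    (Tick, false, inord 0, inord 0) false Stay [::] [::].
  rewrite Ea addn0 /= ffunE /= (ltn_eqF kV) bump_none // (minn_idPl kn').
  move=> H; apply: reach_trans (H VS _ kn' isT erefl) _; first exact: regs_lt.
  have := @program_step (Tick, false, inord 0, inord 0) V (regs k 0 0 0 0) k.+1
    (Count, false, inord 0, inord 0) false Right [::] [::].
  rewrite addn0 /= minnSS (minn_idPl kn).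
  have -> : bump base V (incr (Tick, false, inord 0, inord 0)) (regs k 0 0 0 0) =
    regs k.+1 0 0 0 0.
    apply: funext => -[[|[|[|[|[|i]]]]] Hi] //=.
    by rewrite /bump /= (ltn_eqF kV).
  by apply=> //; apply: regs_lt.
have := widthS k; case: eqP => [E|/eqP ne] EW; last first.
  rewrite addn0 in EW; rewrite EW; apply: tick => //.
  by rewrite ltn_neqAle ne.
have tk := tick _ erefl (trunc_log_ltn k.+1 (isT : 1 < 2)).
apply: (reach_trans _ tk).
have := @program_step (Count, false, inord 0, inord 0) (trunc_log 2 k).+1
   (regs k 0 0 0 0) k.+1 (Count, false, inord 0, inord 0) true Stay [::] [::].
rewrite Ea EW bump_none //= ffunE /= (minn_idPl kn') (introT eqP E) => H.
apply: H => //; first by rewrite -EW /space; lia.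
exact: regs_lt.
Qed.

Let rewinding ip := cfg (Rewind, false, inord 0, inord 0) W (regs n 0 0 0 0) ip [::].

Lemma rewind_loop ip : ip <= n ->
  reach w space (rewinding ip) (printing Entry false 0 0 0 0 0 0 1 [:: Zero; Bar]).
Proof.
elim: ip => [_|ip IH ipn].
  have := @move_step (Rewind, false, inord 0, inord 0) 0 0 0 0 0 _ Right
    [:: Zero; Bar] [::] bound_gt0 bound_gt0 bound_gt0 bound_gt0 isT isT erefl.
  by rewrite bump_none // minnSS min0n.
apply: reach_trans (IH (ltnW ipn)).
have [a0 _] : exists a0 : Sigma, true.
  by move: ipn; rewrite /n; case: (w) => // a; exists a.
have := @move_step (Rewind, false, inord 0, inord 0) 0 0 0 0 ip.+1 _ Left
  [::] [::] bound_gt0 bound_gt0 bound_gt0 bound_gt0 (leqW ipn) isT.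
rewrite [scan _ _]/= (nth_map a0) // => /(_ _ erefl).
by rewrite bump_none //= (minn_idPl (leqW (ltnW ipn))).
Qed.

Definition reduction_word :=
  [:: Zero; Bar] ++ matrix_word false ++ [:: Bar] ++ matrix_word true.

Lemma reduction_machine_run : exists2 cf,
    reach w space (td_init reduction_machine) cf &
    td_action w cf = None /\ td_out cf = reduction_word.
Proof.
have [||||cf H1 H2] := @enc_halt _ _ _ _ _ _ base_gt0 base_le _
  (Start, false, inord 0, inord 0) incr program w space W
  (regs n 0 0 0 0) (ip_at (T * T + T * T)) _ _ _
  (Stop, true, inord 0, inord 0) reduction_word.
- by apply: regs_lt; rewrite ?size_lt_width ?bound_gt0.
- exact: width_lt_space.
- exact: ip_at_le.
- by [].
exists cf => //; apply: reach_trans H1.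
apply: reach_trans (count_loop (leqnn n)) _.
have H : reach w space (counting Count (trunc_log 2 n).+1 n) (rewinding n).
  have := @move_step (Count, false, inord 0, inord 0) 0 0 0 0 n.+1 _ Left
    [::] [::] bound_gt0 bound_gt0 bound_gt0 bound_gt0 (leqnn _) isT.
  rewrite [scan _ _]/= nth_default ?size_map // => /(_ _ erefl).
  by rewrite bump_none //= (minn_idPl (leqnSn n)).
apply: reach_trans H _; apply: reach_trans (rewind_loop (leqnn n)) _.
have := @matrix_loop false 0 [:: Zero; Bar] (or_introl erefl).
rewrite /ip_at minnSS min0n => H; apply: reach_trans H _.
have := @matrix_loop true (T * T)
  ([:: Zero; Bar] ++ matrix_word false ++ [:: Bar]) (or_intror isT).
by rewrite /reduction_word cats0 -!catA.
Qed.

End Word.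
End Program.

(** * The reduction *)

Lemma mem_cons_rem_enum (K : finType) (k0 k : K) : k \in k0 :: rem k0 (enum K).
Proof.
rewrite inE; case: eqVneq => //= ne.
by rewrite mem_rem_uniq ?enum_uniq // !inE ne mem_enum.
Qed.

(** * Numbering of rows and columns *)

Section Decode.
Variables (A B : eqType) (T : nat) (s : seq (A + B)) (k0 : A + B).
Hypothesis sP : forall k, k \in s.

Definition place (t p : nat) (k : A + B) : (nat * nat * A) + (nat * nat * B) :=
  match k with inl a => inl (t, p, a) | inr b => inr (t, p, b) end.

(** The order of the printing loops: the kind varies fastest, then the position, then the time. *)
Definition decode i :=
  place (i %/ size s %/ T) (i %/ size s %% T) (nth k0 s (i %% size s)).

Lemma decodeE t p k : p < T -> k < size s ->
  decode ((t * T + p) * size s + k) = place t p (nth k0 s k).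
Proof.
move=> pT ks; have T0 : 0 < T by apply: leq_ltn_trans pT.
have s0 : 0 < size s by apply: leq_ltn_trans ks.
rewrite /decode divnMDl // (divn_small ks) addn0 divnMDl // (divn_small pT) addn0.
by rewrite !modnMDl !modn_small.
Qed.

Lemma decode_surj t p k : t < T -> p < T ->
  exists i : 'I_(T * T * size s), decode i = place t p k.
Proof.
move=> tT pT; have ks : index k s < size s by rewrite index_mem.
have lt : (t * T + p) * size s + index k s < T * T * size s.
  have digits_lt x y a b : x < a -> y < b -> x * b + y < a * b.
    move=> xa yb; rewrite (@leq_trans (x.+1 * b)) ?leq_mul2r ?xa ?orbT //.
    by rewrite mulSnr ltn_add2l.
  by apply: (digits_lt) => //; apply: (digits_lt).
by exists (Ordinal lt); rewrite /= decodeE // nth_index.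
Qed.

Lemma decode_range (i : 'I_(T * T * size s)) t p k :
  decode i = place t p k -> t < T /\ p < T.
Proof.
have [s0 T0] : 0 < size s /\ 0 < T by have := ltn_ord i; nia.
rewrite /decode => E.
suff [<- <-] : i %/ size s %/ T = t /\ i %/ size s %% T = p.
  by rewrite ltn_mod !ltn_divLR.
by move: E; case: k (nth _ _ _) => [a|b] [a'|b'] // [].
Qed.

End Decode.

(** * The instance written by the transducer *)

Section Reduction.
Variables (Sigma : finType) (M : machine Sigma) (c d : nat) (w : seq Sigma).

Let T := bound c d w.
Let row := decode T (rkinds M) (inl None).
Let col := decode T (ckinds M) (inl None).
Let hd := @tableau_hd Sigma M w.
Let bd := @tableau_bd Sigma M.
Let N := T * T * size (rkinds M).
Let N' := T * T * size (ckinds M).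

Lemma game_gt0 : 0 < N.
Proof. by rewrite !muln_gt0 bound_gt0. Qed.

Definition payoff (ph : bool) i j :=
  if ph then payoffB (row i) (col j) else payoffA hd bd (row i) (col j).

Definition reduction_instance : instance :=
  @Instance N N' (\matrix_(i, j) (payoff false i j)%:R)%R
    (\matrix_(i, j) (payoff true i j)%:R)%R (Ordinal game_gt0).

Lemma payoff_entry ph t p k t' p' k' : p < T -> p' < T ->
    k < size (rkinds M) -> k' < size (ckinds M) ->
  payoff ph ((t * T + p) * size (rkinds M) + k) ((t' * T + p') * size (ckinds M) + k') =
  entry_nat M w ph t p k t' p' k'.
Proof.
move=> pT pT' ks ks'; rewrite /payoff /row /col !decodeE //.
rewrite /entry_nat /entry -/(rkind M k) -/(ckind M k').
case: ph; case: (rkind M k) (ckind M k') => [g|r] [g'|g'] //=.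
by rewrite !xpair_eqE andbA.
by rewrite !xpair_eqE andbA.
Qed.

Lemma encode_payoff ph :
  encode_mx (\matrix_(i < N, j < N') (payoff ph i j)%:R)%R = matrix_word M c d w ph.
Proof.
pose F i := loop (fun j => payoff_word (payoff ph i j)) N' ++ [:: Semicolon].
rewrite /encode_mx; set A := (\matrix_(i, j) _)%R.
have -> : [seq rcons (encode_row (A i)) Semicolon | i <- enum 'I_N] =
          [seq F (val i) | i <- enum 'I_N].
  apply: eq_map => i; rewrite /F -cats1 loop_enum; congr (flatten _ ++ _).
  by apply: eq_map => j; rewrite mxE.
(* Splitting an index loop into time, position and kind yields the nested loops of the program,
   first for rows and then for columns. *)
rewrite -loop_enum loop_mul loop_mul; apply: eq_loop => t tT; apply: eq_loop => p pT.
apply: eq_loop => k ks; rewrite /F; congr (_ ++ _).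
rewrite /N' !loop_mul; apply: eq_loop => t' tT'; apply: eq_loop => p' pT'.
by apply: eq_loop => k' ks'; rewrite payoff_entry.
Qed.

Lemma encode_reduction : encode reduction_instance = reduction_word M c d w.
Proof. by rewrite /reduction_word -!encode_payoff. Qed.

Lemma payoff_lt3 ph i j : payoff ph i j < 3.
Proof.
rewrite /payoff; case: ph; first by apply: leq_ltn_trans (payoffB_le1 _ _) _.
by case: (row i) (col j) => [x|r] [y|y] //=; case: (X in nat_of_bool X).
Qed.

Variable R : realType.
Let A := map_mx (ratr : rat -> R) (row_payoff reduction_instance).
Let B := map_mx (ratr : rat -> R) (col_payoff reduction_instance).

Lemma reduction_values : size (payoff_values A B) <= 3.
Proof.
rewrite -[3]/(size [seq v%:R%R : R | v <- iota 0 3]).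
apply: uniq_leq_size; first exact: undup_uniq.
move=> x; rewrite mem_undup mem_cat => /orP[] /mapP[[i j] _ ->];
  by rewrite !mxE ratr_nat; apply: (map_f (fun v => v%:R%R));
  rewrite mem_iota payoff_lt3.
Qed.

Lemma reduction_strict (L : seq Sigma -> Prop) :
    decides_in_time M L (fun n => c * n ^ d + c) ->
  strict A B (query reduction_instance) <-> L w.
Proof.
move=> dec.
have rP k : k \in rkinds M by apply: mem_cons_rem_enum.
have cP k : k \in ckinds M by apply: mem_cons_rem_enum.
have <- : derivable hd bd (in_range T) (0, 0, None) <-> L w.
  apply: (tableau_derivable dec).
  rewrite /T /bound /radix /width; set W := (trunc_log 2 _).+1.
  have nW : size w < 2 ^ W by apply: trunc_log_ltn.
  (* The bound becomes [(2 ^ W) ^ d * (c + c).+2 ^ W]; a single factor [(c + c).+2] already makes it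
     exceed [c * n ^ d + c] for [n] the input length. *)
  rewrite expnMn -expnM mulnC [d * W]mulnC expnM.
  have h1 : (size w) ^ d <= (2 ^ W) ^ d by case: (d) => // k; rewrite leq_exp2r // ltnW.
  have h2 : (c + c).+2 <= (c + c).+2 ^ W by rewrite -{1}[(c + c).+2]expn1 leq_pexp2l.
  have h3 : 0 < (2 ^ W) ^ d by rewrite !expn_gt0.
  nia.
apply: (strict_derivable (row := fun i => row (val i)) (col := fun j => col (val j))).
- by move=> i j; rewrite !mxE ratr_nat.
- by move=> i j; rewrite !mxE ratr_nat.
- case=> [[t p] r]; split=> [/andP[tT pT]|[i /(decode_range (k := inr r))]].
    exact: (decode_surj (inl None) rP (inr r) tT pT).
  by case=> tT pT; rewrite /in_range /= tT.
- move=> i [[t p] g] /(decode_range (k := inl g))[tT pT].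
  exact: (decode_surj (inl None) cP (inr g) tT pT).
(* Body atoms lie at the time and position of their clause, so their columns exist. *)
- move=> [[t p] r] [[t' p'] g] /andP[tT pT] /and3P[/eqP /= <- /eqP /= <- _].
  exact: (decode_surj (inl None) cP (inl g) tT pT).
- move=> j [[t p] g] /(decode_range (k := inl g))[tT pT].
  exact: (decode_surj (inl None) rP (inl g) tT pT).
by rewrite /row /decode /= !div0n !mod0n.
Qed.

End Reduction.

Theorem theorem6p6 (R : realType) : P_hard (k_strict R 3).
Proof.
move=> Sigma L [M [c [d dec]]]; exists (reduction_word M c d).
  exact: (reach_logspace (reduction_machine_run M c d)).
move=> w; rewrite -(reduction_strict w R dec); split=> [st|[x [E _]]].
  exists (reduction_instance M c d w); rewrite encode_reduction; split=> //.
  exact: reduction_values.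
(* The instance witnessing membership is the constructed one, since words determine instances. *)
by move: E; rewrite -encode_reduction => /encode_inj <-.
Qed.
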